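(* Consider the network binary-observation model with measurement-side tampering and the distributed recursive projection algorithm described in the context, with errors $\widetilde\theta_{k,i}=\theta_{k,i}-\theta$. Suppose that Assumptions 1–4 listed in the context hold and that $p_i+q_i\neq 1$ for every $i\in[n]$. Put $\widetilde\Theta_k=\operatorname{col}\{\widetilde\theta_{k,1},\dots,\widetilde\theta_{k,n}\}\in\mathbb{R}^{pn}$, $\Phi_k=\operatorname{diag}\{\varphi_{k,1},\dots,\varphi_{k,n}\}\in\mathbb{R}^{pn\times n}$ (block diagonal), $\mathbf{P}_k=\operatorname{diag}\{P_{k,1},\dots,P_{k,n}\}\in\mathbb{R}^{pn\times pn}$, and $$r_t:=\max_{i\in[n]}\lambda_{\max}(P_{0,i})+\sum_{i=1}^{n}\sum_{k=0}^{t}\|\varphi_{k,i}\|^2 .$$ Then, as $t\to\infty$, $$\sum_{k=0}^{t}\widetilde\Theta_k^\top\Phi_k\Phi_k^\top\widetilde\Theta_k=O(\log r_t)\quad\text{a.s.},\qquad \widetilde\Theta_{t+1}^\top\mathbf{P}_{t+1}^{-1}\widetilde\Theta_{t+1}=O(\log r_t)\quad\text{a.s.}$$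
   Context: Notation. $[n]=\{1,\dots,n\}$; $\mathbb{S}_{++}^p$ is the set of real symmetric positive definite $p\times p$ matrices; $\lambda_{\max},\lambda_{\min}$ are the largest and smallest eigenvalues of a symmetric matrix; $\|\cdot\|$ is the Euclidean norm; $I\{\cdot\}$ is the indicator; $\operatorname{col}\{x_1,\dots,x_n\}$ stacks vectors into one column vector. The statement $X_t=O(g_t)$ a.s. means that on almost every sample path $X_t=O(g_t)$ as $t\to\infty$, with a constant that may depend on the path. Graph. $G=(V,E,A)$ is an undirected weighted graph with $V=[n]$ and weighted adjacency matrix $A=[a_{ij}]\in\mathbb{R}^{n\times n}$ satisfying $a_{ij}\ge0$, $a_{ij}=a_{ji}$, $\sum_{j=1}^n a_{ij}=1$ for all $i$, and $a_{ij}>0$ only if $(i,j)\in E$ (otherwise $a_{ij}=0$). The neighbor set is $\mathcal N_i=\{j\in V:(i,j)\in E\}=\{j\in V:a_{ij}>0\}$. Model. For $k\ge0$, $i\in[n]$, node $i$ has an observable regressor $\varphi_{k,i}\in\mathbb{R}^p$ and output $y_{k+1,i}=\varphi_{k,i}^\top\theta+w_{k+1,i}$, where $\theta\in\mathbb{R}^p$ is an unknown constant parameter and $w_{k+1,i}$ is noise. A binary sensor with fixed threshold $C\in\mathbb{R}$ produces $s^0_{k+1,i}=I\{y_{k+1,i}\le C\}$. The bit $s_{k+1,i}\in\{0,1\}$ that the estimator receives is a randomly flipped version of it, with known probabilities $p_i,q_i\in[0,1)$: $\Pr\{s_{k+1,i}=0\mid s^0_{k+1,i}=1,\mathcal F_k\}=p_i$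 and $\Pr\{s_{k+1,i}=1\mid s^0_{k+1,i}=0,\mathcal F_k\}=q_i$. Here $\mathcal F_k$ is the filtration generated by $y_{j,i},u_{j,i},w_{j,i},w'_{j,i}$ ($i\in[n]$, $1\le j\le k$) and $u_{0,i}$ ($i\in[n]$), where $u_{j,i}$ are system inputs and $w'_{j,i}$ is a possible exogenous input sequence; the received bits $s_{j,i}$, $j\le k$, are $\mathcal F_k$-measurable. Consequently $\Pr\{s_{k+1,i}=1\mid\mathcal F_k\}=(1-(p_i+q_i))F_{k,i}(C-\theta^\top\varphi_{k,i})+q_i$, with $F_{k,i}$ as in Assumption 3. Assumption 1. There is a known nonempty compact convex set $\Omega\subset\mathbb{R}^p$ with $\theta\in\Omega$; $L:=\sup_{\eta\in\Omega}\|\eta\|<\infty$. Assumption 2. Each $\varphi_{k,i}$ is $\mathcal F_k$-measurable, and $\sup_{k\ge0}\max_{i\in[n]}\|\varphi_{k,i}\|\le M<\infty$ a.s. Assumption 3. For each $k\ge0$, $i\in[n]$, conditional on $\mathcal F_k$, $w_{k+1,i}$ has conditional distribution function $F_{k,i}$ and density $f_{k,i}=F_{k,i}'$; conditional on $\mathcal F_k$, $w_{k+1,1},\dots,w_{k+1,n}$ are independent; and there is a constant $f_{\min}>0$ with $\inf_{k\ge0,\,i\in[n]}\inf_{x\in[C-LM,C+LM]}f_{k,i}(x)\ge f_{\min}$. Assumption 4. The graph $G$ is connected. Projection. For $Q\in\mathbb{S}_{++}^p$, $\Pi_Q(\eta):=\arg\min_{\omega\in\Omega}\|\eta-\omega\|_Q$,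 where $\|\eta\|_Q=\sqrt{\eta^\top Q\eta}$. Algorithm. For each $i\in[n]$ choose $\theta_{0,i}\in\Omega$, $P_{0,i}\in\mathbb{S}_{++}^p$, and set $\beta_i=\operatorname{sign}(1-(p_i+q_i))\min_{j\in[n]}\{|1-(p_j+q_j)|f_{\min}\}$. For $k=0,1,\dots$: Adaptation, for each $i\in[n]$: $a_{k,i}=\big(1+\beta_i^2\varphi_{k,i}^\top P_{k,i}\varphi_{k,i}\big)^{-1}$, $\tilde s_{k+1,i}=(1-(p_i+q_i))F_{k,i}(C-\theta_{k,i}^\top\varphi_{k,i})+q_i-s_{k+1,i}$, $\bar P_{k+1,i}=P_{k,i}-\beta_i^2a_{k,i}P_{k,i}\varphi_{k,i}\varphi_{k,i}^\top P_{k,i}$, $\psi_{k+1,i}=\Pi_{\bar P_{k+1,i}^{-1}}\big(\theta_{k,i}+a_{k,i}\beta_iP_{k,i}\varphi_{k,i}\tilde s_{k+1,i}\big)$. Combination, for each $i\in[n]$: $P_{k+1,i}^{-1}=\sum_{j\in\mathcal N_i}a_{ij}\bar P_{k+1,j}^{-1}$, $\theta_{k+1,i}=P_{k+1,i}\sum_{j\in\mathcal N_i}a_{ij}\bar P_{k+1,j}^{-1}\psi_{k+1,j}$.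
   Formalization: On sample paths where r_t tends to 1 (so log r_t tends to 0, where the literal claim can fail, e.g. zero regressors with largest initial eigenvalue 1), both bounds are stated as O(1) instead of O(log r_t). *)

(* Defs.v *)
From HB Require Import structures.
From mathcomp Require Import all_boot all_order all_algebra.
From mathcomp Require Import all_classical all_reals all_analysis.

Set Implicit Arguments.
Unset Strict Implicit.
Unset Printing Implicit Defensive.

Import Order.TTheory GRing.Theory Num.Theory.
Import numFieldNormedType.Exports.

Local Open Scope classical_set_scope.
Local Open Scope ring_scope.

Definition sym_posdef (R : realType) (p : nat) (Q : 'M[R]_p) : Prop :=
  Q^T = Q /\ forall x : 'cV[R]_p, x != 0 -> 0 < (x^T *m Q *m x) 0 0.

Definition qnorm (R : realType) (p : nat) (Q : 'M[R]_p) (x : 'cV[R]_p) : R :=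
  Num.sqrt ((x^T *m Q *m x) 0 0).

(* The library norm on matrices is the sup norm, hence a separate Euclidean
   norm. *)
Definition enorm (R : realType) (p : nat) (x : 'cV[R]_p) : R :=
  Num.sqrt (\sum_(i < p) x i 0 ^+ 2).

(* Used only for symmetric A of size > 0, whose set of eigenvalues is finite and
   nonempty, so that the supremum is the largest eigenvalue. *)
Definition lambda_max (R : realType) (p : nat) (A : 'M[R]_p) : R :=
  sup [set a | eigenvalue A a].

(* The argmin over Om of the distance to eta in the norm of Q; it exists and is
   unique when Om is nonempty, compact and convex and Q is positive definite.
   The default value 0 of xget is then irrelevant. *)
Definition proj (R : realType) (p : nat) (Om : set 'cV[R]_p) (Q : 'M[R]_p)
    (eta : 'cV[R]_p) : 'cV[R]_p :=
  xget 0 [set om | Om om /\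
    forall om', Om om' -> qnorm Q (eta - om) <= qnorm Q (eta - om')].

Definition edge (R : realType) (n : nat) (A : 'M[R]_n) : rel 'I_n :=
  fun i j => 0 < A i j.

Definition weighted_adjacency (R : realType) (n : nat) (A : 'M[R]_n) : Prop :=
  [/\ forall i j, 0 <= A i j,
      forall i j, A i j = A j i &
      forall i, \sum_(j < n) A i j = 1].

Definition graph_connected (R : realType) (n : nat) (A : 'M[R]_n) : Prop :=
  forall i j : 'I_n, connect (edge A) i j.

Definition measurable_wrt d d' (T : measurableType d) (U : measurableType d')
    (G : set (set T)) (X : T -> U) : Prop :=
  preimage_set_system [set: T] X measurable `<=` G.

(* g is a version of P(E | G), for a sub-sigma-algebra G. *)
Definition is_cond_prob d (T : measurableType d) (R : realType)
    (P : probability T R) (G : set (set T)) (E : set T) (g : T -> R) : Prop :=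
  measurable_wrt G g /\
  forall A, G A -> (\int[P]_(x in A) (g x)%:E = P (E `&` A))%E.

(* P(E | D, G) = c for a constant c: given G, the event E has conditional
   probability c on the event D. *)
Definition cond_prob_on d (T : measurableType d) (R : realType)
    (P : probability T R) (G : set (set T)) (E D : set T) (c : R) : Prop :=
  forall A, G A -> (P (E `&` D `&` A) = c%:E * P (D `&` A))%E.

Definition cond_independent d (T : measurableType d) (R : realType)
    (P : probability T R) (G : set (set T)) (n : nat)
    (X : 'I_n -> T -> R) : Prop :=
  forall (B : 'I_n -> set R) (g : 'I_n -> T -> R),
    (forall i, measurable (B i)) ->
    (forall i, is_cond_prob P G (X i @^-1` B i) (g i)) ->
    is_cond_prob P G (\bigcap_i (X i @^-1` B i))
      (fun x => \prod_(i < n) g i x).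

(* F x is, for every sample point x, a distribution function with density f x,
   and F is a version of the conditional distribution function of X given G.
   The identity f = F' (almost everywhere) follows from the integral form. *)
Definition is_cond_distribution d (T : measurableType d) (R : realType)
    (P : probability T R) (G : set (set T)) (X : T -> R)
    (F f : T -> R -> R) : Prop :=
  [/\ forall x, [/\ measurable_fun [set: R] (f x),
        forall z, 0 <= f x z,
        (\int[@lebesgue_measure R]_z (f x z)%:E = 1)%E &
        forall c, ((F x c)%:E =
          \int[@lebesgue_measure R]_(z in `]-oo, c]) (f x z)%:E)%E] &
      forall c, is_cond_prob P G (X @^-1` `]-oo, c]) (fun x => F x c)].

(* Only the inputs u are observed at time 0. *)
Definition natural_filtration d dU dW (T : measurableType d)
    (U : measurableType dU) (W : measurableType dW) (R : realType) (n : nat)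
    (y : nat -> 'I_n -> T -> R) (u : nat -> 'I_n -> T -> U)
    (w : nat -> 'I_n -> T -> R) (w' : nat -> 'I_n -> T -> W)
    (k : nat) : set (set T) :=
  <<s [set A | exists j i,
        ((0 < j <= k)%N /\
          (preimage_set_system [set: T] (y j i) measurable A \/
           preimage_set_system [set: T] (w j i) measurable A \/
           preimage_set_system [set: T] (w' j i) measurable A)) \/
        ((j <= k)%N /\
          preimage_set_system [set: T] (u j i) measurable A)] >>.

(* The default value of the iterated minimum is one of its arguments. *)
Definition beta_coef (R : realType) (n : nat) (pf qf : 'I_n -> R) (fmin : R)
    (i : 'I_n) : R :=
  Num.sg (1 - (pf i + qf i)) *
  \big[Num.min/`|1 - (pf i + qf i)| * fmin]_(j < n)
     (`|1 - (pf j + qf j)| * fmin).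

Definition gain (R : realType) (p : nat) (beta : R) (P : 'M[R]_p)
    (phi : 'cV[R]_p) : R :=
  (1 + beta ^+ 2 * (phi^T *m P *m phi) 0 0)^-1.

(* A run of the algorithm along one sample path: F k i is the conditional
   distribution function F_{k,i} on that path and s k i the received bit. *)
Record algorithm_run (R : realType) (n p : nat) (A : 'M[R]_n)
    (Om : set 'cV[R]_p) (C : R) (pf qf : 'I_n -> R) (beta : 'I_n -> R)
    (theta0 : 'I_n -> 'cV[R]_p) (P0 : 'I_n -> 'M[R]_p)
    (phi : nat -> 'I_n -> 'cV[R]_p) (F : nat -> 'I_n -> R -> R)
    (s : nat -> 'I_n -> bool)
    (theta : nat -> 'I_n -> 'cV[R]_p) (P : nat -> 'I_n -> 'M[R]_p)
    (psi : nat -> 'I_n -> 'cV[R]_p) (Pbar : nat -> 'I_n -> 'M[R]_p)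
    : Prop := AlgorithmRun {
  run_theta0 : forall i, theta 0%N i = theta0 i;
  run_P0 : forall i, P 0%N i = P0 i;
  run_Pbar : forall k i,
    Pbar k.+1 i = P k i - (beta i ^+ 2 * gain (beta i) (P k i) (phi k i)) *:
                    (P k i *m phi k i *m (phi k i)^T *m P k i);
  run_psi : forall k i,
    let stilde := (1 - (pf i + qf i)) *
                    F k i (C - ((theta k i)^T *m phi k i) 0 0)
                  + qf i - (s k.+1 i)%:R in
    psi k.+1 i = proj Om (invmx (Pbar k.+1 i))
      (theta k i + (gain (beta i) (P k i) (phi k i) * beta i * stilde) *:
                     (P k i *m phi k i));
  run_P : forall k i,
    invmx (P k.+1 i) = \sum_(j | edge A i j) A i j *: invmx (Pbar k.+1 j);
  run_theta : forall k i,
    theta k.+1 i = P k.+1 i *m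
      \sum_(j | edge A i j) A i j *: (invmx (Pbar k.+1 j) *m psi k.+1 j)
}.

Definition stack_col (R : realType) (n p : nat) (x : 'I_n -> 'cV[R]_p) :
    'cV[R]_(\sum_(i < n) p) :=
  \mxcol_(i < n) x i.

Definition stack_diag (R : realType) (n p q : nat) (B : 'I_n -> 'M[R]_(p, q)) :
    'M[R]_(\sum_(i < n) p, \sum_(i < n) q) :=
  \mxblock_(i < n, j < n) (B i *+ (i == j)).

(* The maximum is over positive numbers when the P0 i are positive definite, so
   starting the iteration at 0 is harmless. *)
Definition rsum (R : realType) (n p : nat) (P0 : 'I_n -> 'M[R]_p)
    (phi : nat -> 'I_n -> 'cV[R]_p) (t : nat) : R :=
  \big[Num.max/0]_(i < n) lambda_max (P0 i)
  + \sum_(i < n) \sum_(0 <= k < t.+1) enorm (phi k i) ^+ 2.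

(* X_t = O(log r_t), read literally unless r_t --> 1. In that exceptional case
   log r_t tends to 0 (it can even vanish for all t: no excitation and largest
   initial eigenvalue 1), and X_t = O(1) is required instead, which is what
   O(log r_t) means for every other finite limit of r_t. *)
Definition bigO_log (R : realType) (X r : nat -> R) : Prop :=
  (~ (r t @[t --> \oo] --> (1 : R)) ->
     (X : nat -> R^o) =O_\oo ((fun t => ln (r t)) : nat -> R^o)) /\
  (r t @[t --> \oo] --> (1 : R) ->
     (X : nat -> R^o) =O_\oo ((fun=> 1) : nat -> R^o)).

(* Main.v *)
(* Put V_k = sum_i e_{k,i}^T P_{k,i}^-1 e_{k,i} with e = theta_hat - theta. Being
   a matrix-weighted average, theta_{k,i} may leave Omega, where no lower bound
   on the density is available, so nonexpansiveness of the projection alone does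
   not suffice: the predicted residual m = phi^T e is compared with its clipped
   value mc (phi^T theta_{k,i} truncated to [-LM, LM]), and the gap m - mc is paid
   for by the displacement that the projection causes. Up to constants, each
   adaptation step then lowers V by mc^2 + (m - mc)^2, at the price of
   phi^T P phi and of a noise term beta * d * mc with d of conditional mean zero;
   the combination step does not increase V.
   The terms phi^T P phi telescope into sum_i ln det P_{t+1,i}^-1 because ln det is
   concave and the weights are doubly stochastic, and Hadamard's inequality bounds
   that by a multiple of ln r_t.
   For each node separately, the products prod_k (1 + v_k d_k), with v_k a small
   multiple of mc, form a nonnegative martingale, which is almost surely bounded
   by the maximal inequality; taking logarithms, the noise sum is at most a small
   multiple of sum mc^2 plus a random constant. *)

Require Import Defs.
From HB Require Import structures.
From mathcomp Require Import all_boot all_order all_algebra.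
From mathcomp Require Import all_classical all_reals all_analysis.
From mathcomp Require Import measurable_realfun ring lra.
From mathcomp Require complex.

Set Implicit Arguments.
Unset Strict Implicit.
Unset Printing Implicit Defensive.

Import Order.TTheory GRing.Theory Num.Theory.
Import numFieldNormedType.Exports.

Local Open Scope classical_set_scope.
Local Open Scope ring_scope.

(** * Quadratic forms and positive definite matrices *)

(** The innovation multiplies the residual z = phi^T (psi - theta) after the projection, and psi
    already depends on the bit whose noise is to average out. So z is traded for the predicted
    residual m, and in the noise term m for mc. Both errors are at most |z - m|, because phi^T psi
    lies in the clipping interval, and (z - m)^2 is at most phi^T P phi times the squared P^-1-norm
    of psi - theta_hat, a quantity that the projection inequality supplies with a negative sign.
    Young's inequality then leaves a multiple of phi^T P phi, and the unspent part yields (m - mc)^2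
    because phi^T P phi is uniformly bounded. The clipped mc is bounded, as the logarithm of 1 + v d
    requires, and must be known at time k. This is the measure-theoretic burden: the estimates
    contain an argmin over a set and conditional distribution functions at random arguments, whereas
    conditional probabilities are given for fixed thresholds. The argmin is a limit of selections
    from a countable dense set; random arguments are approximated from above by countably valued
    ones, by right continuity. *)

Definition bform (R : realType) (p : nat) (Q : 'M[R]_p) (x y : 'cV[R]_p) : R :=
  (x^T *m Q *m y) 0 0.

Definition dotv (R : realType) (p : nat) (x y : 'cV[R]_p) : R :=
  (x^T *m y) 0 0.

Section bilinear.
Context (R : realType) (p : nat).
Implicit Types (Q : 'M[R]_p) (x y z : 'cV[R]_p) (a : R).

Lemma dotvE x y : dotv x y = \sum_i x i 0 * y i 0.
Proof. by rewrite /dotv mxE; apply: eq_bigr => i _; rewrite [X in X * _]mxE. Qed.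

Lemma dotvC x y : dotv x y = dotv y x.
Proof. by rewrite !dotvE; apply: eq_bigr => i _; rewrite mulrC. Qed.

Lemma dotvDr x y z : dotv x (y + z) = dotv x y + dotv x z.
Proof. by rewrite /dotv mulmxDr mxE. Qed.

Lemma dotvZr x a y : dotv x (a *: y) = a * dotv x y.
Proof. by rewrite /dotv -scalemxAr mxE. Qed.

Lemma dotvNr x y : dotv x (- y) = - dotv x y.
Proof. by rewrite -scaleN1r dotvZr mulN1r. Qed.

Lemma dotvBr x y z : dotv x (y - z) = dotv x y - dotv x z.
Proof. by rewrite dotvDr dotvNr. Qed.

Lemma dotv_ge0 x : 0 <= dotv x x.
Proof. by rewrite dotvE sumr_ge0 // => i _; rewrite -expr2 sqr_ge0. Qed.

Lemma dotv_enorm x : dotv x x = enorm x ^+ 2.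
Proof.
rewrite /enorm sqr_sqrtr; last by rewrite sumr_ge0 // => i _; rewrite sqr_ge0.
by rewrite dotvE; apply: eq_bigr => i _; rewrite expr2.
Qed.

Lemma dotv_eq0 x : dotv x x = 0 -> x = 0.
Proof.
rewrite dotvE => /eqP; rewrite psumr_eq0 => [/allP h|i _]; last by rewrite -expr2 sqr_ge0.
apply/matrixP => i j; rewrite ord1 [RHS]mxE; apply/eqP.
by have := h i (mem_index_enum _); rewrite mulf_eq0 orbb.
Qed.

Lemma bform_dotv Q x y : bform Q x y = dotv x (Q *m y).
Proof. by rewrite /bform /dotv mulmxA. Qed.

Lemma bformDr Q x y z : bform Q x (y + z) = bform Q x y + bform Q x z.
Proof. by rewrite !bform_dotv mulmxDr dotvDr. Qed.

Lemma bformZr Q x a y : bform Q x (a *: y) = a * bform Q x y.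
Proof. by rewrite !bform_dotv -scalemxAr dotvZr. Qed.

Lemma bformDl Q x y z : bform Q (x + y) z = bform Q x z + bform Q y z.
Proof. by rewrite /bform raddfD /= !mulmxDl mxE. Qed.

Lemma bformZl Q x a y : bform Q (a *: x) y = a * bform Q x y.
Proof. by rewrite /bform linearZ /= -!scalemxAl mxE. Qed.

Lemma bformNr Q x y : bform Q x (- y) = - bform Q x y.
Proof. by rewrite -scaleN1r bformZr mulN1r. Qed.

Lemma bformNl Q x y : bform Q (- x) y = - bform Q x y.
Proof. by rewrite -scaleN1r bformZl mulN1r. Qed.

Lemma bform0l Q y : bform Q 0 y = 0.
Proof. by rewrite -(scale0r 0) bformZl mul0r. Qed.

Lemma bform0r Q y : bform Q y 0 = 0.
Proof. by rewrite -(scale0r 0) bformZr mul0r. Qed.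

Definition bformE := (bformDr, bformDl, bformZr, bformZl, bformNr, bformNl).

Lemma bformC Q x y : Q^T = Q -> bform Q x y = bform Q y x.
Proof.
move=> sQ; rewrite /bform; have -> : (x^T *m Q *m y) 0 0 = (x^T *m Q *m y)^T 0 0.
  by rewrite [RHS]mxE.
by rewrite !trmx_mul trmxK sQ mulmxA.
Qed.

Lemma bform_mxD Q Q' x y : bform (Q + Q') x y = bform Q x y + bform Q' x y.
Proof. by rewrite /bform mulmxDr mulmxDl mxE. Qed.

Lemma bform_mxZ a Q x y : bform (a *: Q) x y = a * bform Q x y.
Proof. by rewrite /bform -scalemxAr -scalemxAl mxE. Qed.

Lemma bform_mxsum (I : finType) (w : I -> R) (S : I -> 'M[R]_p) x y :
  bform (\sum_j w j *: S j) x y = \sum_j w j * bform (S j) x y.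
Proof.
rewrite /bform mulmx_sumr mulmx_suml summxE; apply: eq_bigr => j _.
by rewrite -scalemxAr -scalemxAl mxE.
Qed.

Lemma bform_outer x y z : bform (x *m x^T) y z = dotv x y * dotv x z.
Proof.
rewrite (dotvC x y) /bform.
have -> : y^T *m (x *m x^T) *m z = (y^T *m x) *m (x^T *m z) by rewrite !mulmxA.
by rewrite [y^T *m x]mx11_scalar mul_scalar_mx [LHS]mxE.
Qed.

Lemma bform_delta Q i j : bform Q (delta_mx i 0) (delta_mx j 0) = Q i j.
Proof. by rewrite /bform trmx_delta -rowE -colE !mxE. Qed.

End bilinear.

Section posdef.
Context (R : realType) (p : nat).
Implicit Types (Q S : 'M[R]_p) (x y z : 'cV[R]_p) (a : R).

Lemma posdef_gt0 Q x : sym_posdef Q -> x != 0 -> 0 < bform Q x x.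
Proof. by case=> _; apply. Qed.

Lemma posdef_ge0 Q x : sym_posdef Q -> 0 <= bform Q x x.
Proof.
move=> hQ; have [->|x0] := eqVneq x 0; first by rewrite bform0l.
exact/ltW/posdef_gt0.
Qed.

Lemma posdef_sym Q : sym_posdef Q -> Q^T = Q.
Proof. by case. Qed.

Lemma posdefC Q x y : sym_posdef Q -> bform Q x y = bform Q y x.
Proof. by move=> hQ; apply/bformC/posdef_sym. Qed.

Lemma posdef_CauchySchwarz Q x y : sym_posdef Q ->
  bform Q x y ^+ 2 <= bform Q x x * bform Q y y.
Proof.
move=> hQ; have [->|y0] := eqVneq y 0; first by rewrite !bform0r mulr0 expr0n.
have yy := posdef_gt0 hQ y0.
have := posdef_ge0 (bform Q y y *: x - bform Q x y *: y) hQ.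
rewrite !bformE (posdefC y x hQ); set b := bform Q x y; set c := bform Q y y.
set d := bform Q x x => h.
have {}h : 0 <= c * (d * c - b ^+ 2) by move: h; congr (_ <= _); ring.
by rewrite -subr_ge0; move: h; rewrite pmulr_rge0.
Qed.

Lemma dotv_CauchySchwarz x y : dotv x y ^+ 2 <= dotv x x * dotv y y.
Proof.
have h1 : sym_posdef (1%:M : 'M[R]_p).
  split=> [|z z0]; first by rewrite trmx1.
  rewrite mulmx1 -/(dotv z z) lt_def dotv_ge0 andbT.
  by apply: contra_neq z0; exact: dotv_eq0.
by have := posdef_CauchySchwarz x y h1; rewrite !bform_dotv !mul1mx.
Qed.

Lemma dotv_le_enorm x y : `|dotv x y| <= enorm x * enorm y.
Proof.
have N0 : 0 <= enorm x * enorm y by rewrite mulr_ge0 // sqrtr_ge0.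
rewrite -(ler_pXn2r (isT : (0 < 2)%N)) ?nnegrE // real_normK ?num_real // exprMn.
by rewrite -!dotv_enorm; exact: dotv_CauchySchwarz.
Qed.

Lemma posdef_unit Q : sym_posdef Q -> Q \in unitmx.
Proof.
move=> hQ; rewrite -row_free_unit -kermx_eq0; apply/negPn/negP => /rowV0Pn[v].
move=> /sub_kermxP vQ v0; have := @posdef_gt0 Q v^T hQ.
rewrite /bform trmxK vQ mul0mx mxE ltxx => h.
by have := h (contra_neq (fun e => trmx_inj (etrans e (esym (@trmx0 _ _ _)))) v0).
Qed.

Lemma posdef_mulV Q : sym_posdef Q -> Q *m invmx Q = 1%:M.
Proof. by move=> hQ; rewrite mulmxV // posdef_unit. Qed.

Lemma posdef_Vmul Q : sym_posdef Q -> invmx Q *m Q = 1%:M.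
Proof. by move=> hQ; rewrite mulVmx // posdef_unit. Qed.

Lemma posdef_inv Q : sym_posdef Q -> sym_posdef (invmx Q).
Proof.
move=> hQ; split=> [|x x0]; first by rewrite trmx_inv posdef_sym.
set y := invmx Q *m x.
have xE : x = Q *m y by rewrite /y mulmxA posdef_mulV // mul1mx.
have y0 : y != 0 by apply: contra_neq x0; rewrite xE => ->; rewrite mulmx0.
have := posdef_gt0 hQ y0; rewrite /bform.
rewrite -mulmxA -xE => h; rewrite -mulmxA -/y; move: h.
by rewrite -!/(dotv _ _) dotvC.
Qed.

Lemma posdef_add_outer Q x a : 0 <= a -> sym_posdef Q ->
  sym_posdef (Q + a *: (x *m x^T)).
Proof.
move=> a0 hQ; split=> [|y y0].
  by rewrite raddfD /= linearZ /= trmx_mul trmxK posdef_sym.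
rewrite -[_ 0 0]/(bform _ y y) bform_mxD bform_mxZ bform_outer -expr2.
by rewrite ltr_pwDl // ?posdef_gt0 // mulr_ge0 // sqr_ge0.
Qed.

Lemma posdef_sum (I : finType) (w : I -> R) (S : I -> 'M[R]_p) :
  (forall j, 0 <= w j) -> \sum_j w j = 1 -> (forall j, sym_posdef (S j)) ->
  sym_posdef (\sum_j w j *: S j).
Proof.
move=> w0 w1 hS; split=> [|x x0].
  rewrite raddf_sum /=; apply: eq_bigr => j _.
  by rewrite linearZ /= posdef_sym.
rewrite -[_ 0 0]/(bform _ x x) bform_mxsum lt_neqAle sumr_ge0 ?andbT; last first.
  by move=> j _; rewrite mulr_ge0 // posdef_ge0.
rewrite eq_sym psumr_eq0 => [|j _]; last by rewrite mulr_ge0 // posdef_ge0.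
apply/negP => /allP h; move: w1; rewrite big1 => [/esym/eqP|j _].
  by rewrite oner_eq0.
have /= := h j (mem_index_enum _); rewrite mulf_eq0 => /orP[/eqP//|].
by rewrite gt_eqF // posdef_gt0.
Qed.

(** Stands in for a bound on the smallest eigenvalue: [x i 0] is the [invmx Q]-product of a unit
    vector with [Q *m x], so Cauchy-Schwarz bounds its square by a diagonal entry of [invmx Q] times
    the form. *)
Lemma posdef_dotv_le Q x : sym_posdef Q ->
  dotv x x <= \tr (invmx Q) * bform Q x x.
Proof.
move=> hQ; rewrite /mxtrace dotvE mulr_suml; apply: ler_sum => i _.
rewrite -expr2 -bform_delta.
set e := delta_mx i 0.
have -> : x i 0 = bform (invmx Q) e (Q *m x).
  by rewrite bform_dotv mulmxA posdef_Vmul // mul1mx dotvE (bigD1 i) //= !mxE eqxx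
    mul1r big1 ?addr0 // => j ji; rewrite !mxE (negbTE ji) mul0r.
have -> : bform Q x x = bform (invmx Q) (Q *m x) (Q *m x).
  by rewrite [RHS]bform_dotv mulmxA posdef_Vmul // mul1mx bform_dotv dotvC.
exact/posdef_CauchySchwarz/posdef_inv.
Qed.

(** With [a = beta ^+ 2] the matrix inverted on the left is the covariance update of the algorithm;
    in information form the adaptation merely adds a rank-one term. *)
Lemma invmx_Sherman_Morrison Q x a : 0 <= a -> sym_posdef Q ->
  invmx (Q - (a * (1 + a * bform Q x x)^-1) *: (Q *m x *m x^T *m Q)) =
  invmx Q + a *: (x *m x^T).
Proof.
move=> a0 hQ; set c := bform Q x x; set k := a * _.
have c0 : 0 <= c by exact: posdef_ge0.
have d0 : 1 + a * c != 0 by rewrite gt_eqF // ltr_pwDl // mulr_ge0.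
have key : (invmx Q + a *: (x *m x^T)) *m (Q - k *: (Q *m x *m x^T *m Q)) = 1%:M.
  rewrite mulmxDl !mulmxBr posdef_Vmul // -!scalemxAl -!scalemxAr.
  rewrite !mulmxA posdef_Vmul // mul1mx.
  have -> : x *m x^T *m Q *m x *m x^T *m Q = c *: (x *m x^T *m Q).
    rewrite -!(mulmxA x) [x^T *m Q *m x]mx11_scalar -/(bform Q x x) -/c.
    by rewrite mul_scalar_mx -!scalemxAl -!scalemxAr mulmxA.
  set W := x *m x^T *m Q.
  rewrite -addrA -[RHS]addr0; congr (_ + _).
  rewrite !scalerA -!scaleNr -!scalerDl -[RHS](scale0r W); congr (_ *: _).
  by rewrite /k /GRing.scale /=; field.
have [u1 u2] := mulmx1_unit key.
rewrite -[LHS]mul1mx -key -mulmxA mulmxV // mulmx1 //.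
Qed.

End posdef.

(** * Determinants of positive definite matrices *)

Section logdet.
Context (R : realType).

Lemma bform_block (p : nat) (a t : R) (v x : 'cV[R]_p) (D : 'M[R]_p) :
  let y : 'cV[R]_(1 + p) := col_mx t%:M x in
  bform (block_mx a%:M v^T v D) y y =
  a * t ^+ 2 + 2 * t * dotv v x + bform D x x.
Proof.
have mxD1 (A B : 'M[R]_1) : (A + B) 0 0 = A 0 0 + B 0 0 by rewrite mxE.
have mxZ1 k (B : 'M[R]_1) : (k *: B) 0 0 = k * B 0 0 by rewrite mxE.
move=> y; rewrite /y /bform tr_col_mx mul_row_block mul_row_col.
rewrite !mulmxDl !tr_scalar_mx -!scalar_mxM !mul_scalar_mx mul_mx_scalar.
rewrite -scalemxAl !mxD1 !mxZ1 -/(dotv x v) -/(dotv v x) (dotvC x).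
by rewrite -/(bform D x x) [X in X + _ + _]mxE eqxx mulr1n; ring.
Qed.

Lemma posdef_schur (p : nat) (Q : 'M[R]_(1 + p)) : sym_posdef Q ->
  let a := Q 0 0 in let v := dlsubmx Q in
  [/\ 0 < a, Q = block_mx a%:M v^T v (drsubmx Q) &
      sym_posdef (drsubmx Q - a^-1 *: (v *m v^T))].
Proof.
move=> hQ a v.
have a0 : 0 < a.
  rewrite /a -bform_delta posdef_gt0 //; apply/eqP => /matrixP/(_ 0 0)/eqP.
  by rewrite !mxE eqxx oner_eq0.
have QE : Q = block_mx a%:M v^T v (drsubmx Q).
  rewrite -[LHS]submxK; congr block_mx.
    rewrite [LHS]mx11_scalar !mxE /a; congr (Q _ _)%:M; exact/val_inj.
  by rewrite /v -[in LHS](posdef_sym hQ); apply/matrixP => i j; rewrite !mxE.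
split => //; split=> [|x x0].
  rewrite raddfB /= linearZ /= trmx_mul trmxK; congr (_ - _).
  by apply/matrixP => i j; rewrite !mxE -[in LHS](posdef_sym hQ) mxE.
rewrite -[_ 0 0]/(bform _ x x).
(* This [t] minimises the block form for fixed [x]; the minimum is the form of the Schur
   complement. *)
set t := - (a^-1 * dotv v x).
have y0 : col_mx (t%:M : 'cV_1) x != 0.
  apply: contra_neq x0 => /(congr1 dsubmx); rewrite col_mxKd => ->.
  by apply/matrixP => i j; rewrite !mxE.
have := posdef_gt0 hQ y0; rewrite [X in bform X]QE bform_block.
rewrite bform_mxD -scaleNr bform_mxZ bform_outer; congr (_ < _).
by rewrite /t; field; rewrite gt_eqF.
Qed.

(** Replaces a spectral decomposition: the triangular factor gives the determinant as a product of
    squares and serves as a square root in congruences. *)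
Lemma cholesky (p : nat) (Q : 'M[R]_p) : sym_posdef Q ->
  exists2 B : 'M[R]_p, is_trig_mx B & Q = B *m B^T.
Proof.
elim: p Q => [|p IH] Q hQ.
  exists 0; last by apply/matrixP => -[].
  by apply/is_trig_mxP => -[].
have [a0 QE hS] := posdef_schur (hQ : sym_posdef (Q : 'M[R]_(1 + p))).
have [B tB BE] := IH _ hS.
set a := Q 0 0 in a0 QE BE *; set v := dlsubmx _ in QE BE *.
have sa : Num.sqrt a * Num.sqrt a = a by rewrite -expr2 sqr_sqrtr // ltW.
have sa0 : Num.sqrt a != 0 by rewrite gt_eqF // sqrtr_gt0.
pose C : 'M[R]_(1 + p) := block_mx (Num.sqrt a)%:M 0 ((Num.sqrt a)^-1 *: v) B.
have tC : is_trig_mx C.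
  by rewrite is_trig_block_mx // eqxx tB andbT /= scalar_mx_is_trig.
suff CE : Q = C *m C^T :> 'M[R]_(1 + p) by exists C.
rewrite [LHS]QE tr_block_mx mulmx_block trmx0 !mul0mx !mulmx0 !addr0.
rewrite !tr_scalar_mx -scalar_mxM sa mul_scalar_mx mul_mx_scalar linearZ /=.
rewrite !scalerA mulfV // !scale1r -scalemxAl -scalemxAr scalerA -invfM sa -BE.
by congr block_mx; rewrite addrC subrK.
Qed.

(** Hadamard's inequality: the determinant is the product of the squared diagonal entries of the
    Cholesky factor, while [Q i i] is the squared length of its whole i-th row. *)
Lemma posdef_det_bounds (p : nat) (Q : 'M[R]_p) : sym_posdef Q ->
  0 < \det Q <= \prod_(i < p) Q i i.
Proof.
move=> hQ; have [B tB BE] := cholesky hQ.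
have detE : \det Q = \prod_(i < p) B i i ^+ 2.
  by rewrite BE det_mulmx det_tr det_trig // -expr2 prodrXl.
apply/andP; split.
  have := posdef_unit hQ; rewrite unitmxE unitfE detE lt_def => -> /=.
  by rewrite prodr_ge0 // => i _; rewrite sqr_ge0.
rewrite detE; apply: ler_prod => i _; rewrite sqr_ge0 /= BE mxE (bigD1 i) //=.
rewrite mxE -expr2 lerDl sumr_ge0 // => j _.
by rewrite mxE -expr2 sqr_ge0.
Qed.

Lemma posdef_det_gt0 (p : nat) (Q : 'M[R]_p) : sym_posdef Q -> 0 < \det Q.
Proof. by case/posdef_det_bounds/andP. Qed.

Lemma posdef_diag_gt0 (p : nat) (Q : 'M[R]_p) i : sym_posdef Q -> 0 < Q i i.
Proof.
move=> hQ; rewrite -bform_delta posdef_gt0 //; apply/eqP => /matrixP/(_ i 0)/eqP.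
by rewrite !mxE !eqxx oner_eq0.
Qed.

Lemma posdef_tr_ge0 (p : nat) (Q : 'M[R]_p) : sym_posdef Q -> 0 <= \tr Q.
Proof. by move=> hQ; apply: sumr_ge0 => i _; apply/ltW/posdef_diag_gt0. Qed.

Lemma lndet_le_tr (p : nat) (Q : 'M[R]_p) : sym_posdef Q ->
  ln (\det Q) <= \tr Q - p%:R.
Proof.
move=> hQ; have /andP[d0 dle] := posdef_det_bounds hQ.
rewrite -[leRHS]expRK ler_ln ?posrE ?expR_gt0 //; apply: le_trans dle _.
have -> : \tr Q - p%:R = \sum_(i < p) (Q i i - 1).
  by rewrite sumrB sumr_const card_ord.
rewrite expR_sum; apply: ler_prod => i _; rewrite ltW ?posdef_diag_gt0 //=.
by have := expR_ge1Dx (Q i i - 1); rewrite addrC subrK.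
Qed.

Lemma lndet_le_lntr (p : nat) (Q : 'M[R]_p) (c : R) : sym_posdef Q ->
  \tr Q <= c -> ln (\det Q) <= p%:R * ln c.
Proof.
move=> hQ trc; have /andP[d0 dle] := posdef_det_bounds hQ.
have [p0|p0] := posnP p.
  by subst p; rewrite mul0r [\det Q]det_mx00 ln1.
have tr0 : 0 < \tr Q.
  rewrite /mxtrace (bigD1 (Ordinal p0)) //= ltr_pwDl ?posdef_diag_gt0 //.
  by rewrite sumr_ge0 // => i _; rewrite ltW // posdef_diag_gt0.
have c0 := lt_le_trans tr0 trc.
rewrite mulr_natl -lnXn // ler_ln ?posrE ?exprn_gt0 //; apply: le_trans dle _.
rewrite -[X in c ^+ X]card_ord -prodr_const; apply: ler_prod => i _.
rewrite ltW ?posdef_diag_gt0 //=; apply: le_trans trc.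
rewrite /mxtrace (bigD1 i) //= lerDl sumr_ge0 // => j _.
by rewrite ltW // posdef_diag_gt0.
Qed.

(** The tangent inequality at [Y] for the concave function ln det. Congruence by the inverse
    Cholesky factor of [Y] reduces it to [Y = 1], which is [lndet_le_tr]. *)
Lemma lndetB_le (p : nat) (X Y : 'M[R]_p) : sym_posdef X -> sym_posdef Y ->
  ln (\det X) - ln (\det Y) <= \tr (X *m invmx Y) - p%:R.
Proof.
move=> hX hY; have [B _ YE] := cholesky hY.
have uB : B \in unitmx.
  by have := posdef_unit hY; rewrite YE unitmx_mul => /andP[].
pose Z := invmx B *m X *m (invmx B)^T.
have hZ : sym_posdef Z.
  split=> [|x x0]; first by rewrite /Z !trmx_mul trmxK (posdef_sym hX) mulmxA.
  have y0 : (invmx B)^T *m x != 0.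
    apply: contra_neq x0 => /(congr1 (mulmx B^T)).
    by rewrite mulmxA -trmx_mul mulVmx // trmx1 mul1mx mulmx0.
  by have := posdef_gt0 hX y0; rewrite /bform trmx_mul trmxK /Z !mulmxA.
have trE : \tr Z = \tr (X *m invmx Y).
  rewrite /Z -mulmxA mxtrace_mulC -mulmxA; congr (\tr (_ *m _)).
  rewrite YE trmx_inv; apply: (can_inj (mulKmx (_ : B *m B^T \in unitmx))).
    by rewrite unitmx_mul uB unitmx_tr.
  rewrite mulmxV ?unitmx_mul ?uB ?unitmx_tr // -!mulmxA [B^T *m _]mulmxA.
  by rewrite mulmxV ?unitmx_tr // mul1mx mulmxV.
have detE : \det Z = \det X / \det Y.
  rewrite /Z !det_mulmx det_tr det_inv YE det_mulmx det_tr invfM; ring.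
rewrite -trE -ln_div ?posrE ?posdef_det_gt0 // -detE.
exact: lndet_le_tr.
Qed.

(** Jensen's inequality from the tangents at the mean [X]: their linear terms average to tr(X X^-1)
    - p = 0. *)
Lemma lndet_concave (p : nat) (I : finType) (w : I -> R) (S : I -> 'M[R]_p) :
  (forall j, 0 <= w j) -> \sum_j w j = 1 -> (forall j, sym_posdef (S j)) ->
  \sum_j w j * ln (\det (S j)) <= ln (\det (\sum_j w j *: S j)).
Proof.
move=> w0 w1 hS; set X := \sum_j _ *: _.
have hX : sym_posdef X by exact: posdef_sum.
have : \sum_j w j * (ln (\det (S j)) - ln (\det X)) <=
       \sum_j w j * (\tr (S j *m invmx X) - p%:R).
  by apply: ler_sum => j _; apply: ler_wpM2l => //; apply: lndetB_le.
under eq_bigr do rewrite mulrBr.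
under [leRHS]eq_bigr do rewrite mulrBr.
rewrite !sumrB -!mulr_suml w1 !mul1r.
have -> : \sum_j w j * \tr (S j *m invmx X) = p%:R.
  rewrite -[RHS](mxtrace1 R p) -(posdef_mulV hX) mulmx_suml raddf_sum /=.
  by apply: eq_bigr => j _; rewrite -scalemxAl mxtraceZ.
by rewrite subrr subr_le0.
Qed.

End logdet.

(** * Projection, fusion and eigenvalues *)

Lemma cvg_sumr (R : realType) (I : finType) (T : Type) (F : set_system T)
    {FF : Filter F} (f : I -> T -> R) (l : I -> R) :
  (forall i, f i x @[x --> F] --> l i) ->
  \sum_i f i x @[x --> F] --> \sum_i l i.
Proof.
move=> h; elim: (index_enum I) => [|i s IH].
  rewrite big_nil; under eq_fun do rewrite big_nil.
  exact: cvg_cst.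
rewrite big_cons; under eq_fun do rewrite big_cons.
exact: cvgD.
Qed.

Section projection.
Context (R : realType) (p : nat).
Implicit Types (Q : 'M[R]_p) (x eta : 'cV[R]_p).

Lemma bform_continuous Q eta :
  continuous (fun x : 'cV[R]_p => bform Q (eta - x) (eta - x)).
Proof.
move=> x.
have coord i : (eta - y) i 0 @[y --> nbhs x] --> (eta - x) i 0.
  rewrite (_ : (eta - x) i 0 = eta i 0 - x i 0); last by rewrite !mxE.
  rewrite (_ : (fun y => _) = (fun y : 'cV[R]_p => eta i 0 - y i 0)); last first.
    by apply/funext => y; rewrite !mxE.
  apply: cvgB; first exact: cvg_cst.
  exact: (@coord_continuous R p 1 i 0 x).
have E y : bform Q y y = \sum_i y i 0 * \sum_j Q i j * y j 0.
  by rewrite bform_dotv dotvE; apply: eq_bigr => i _; rewrite [X in _ * X]mxE.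
rewrite /continuous_at E (_ : (fun y => _) = (fun y : 'cV[R]_p =>
    \sum_i (eta - y) i 0 * \sum_j Q i j * (eta - y) j 0)); last first.
  by apply/funext => y; rewrite E.
apply: (@cvg_sumr R _ _ (nbhs x) (nbhs_filter x)) => i.
apply: cvgM; first exact: coord.
apply: (@cvg_sumr R _ _ (nbhs x) (nbhs_filter x)) => j.
by apply: cvgM; [exact: cvg_cst|exact: coord].
Qed.

Lemma qnorm_le Q x y : sym_posdef Q ->
  (qnorm Q x <= qnorm Q y) = (bform Q x x <= bform Q y y).
Proof. by move=> hQ; rewrite /qnorm ler_sqrt // posdef_ge0. Qed.

Section convex_set.
Context (Om : set 'cV[R]_p) (Om0 : Om !=set0) (Omk : compact Om)
  (Omc : convex_set Om).

Lemma proj_min Q eta : sym_posdef Q -> Om (Defs.proj Om Q eta) /\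
  forall x, Om x -> bform Q (eta - Defs.proj Om Q eta) (eta - Defs.proj Om Q eta) <=
                    bform Q (eta - x) (eta - x).
Proof.
move=> hQ; have cf : {within Om, continuous (fun x : 'cV[R]_p => bform Q (eta - x) (eta - x))}.
  by apply: continuous_subspaceT; exact: bform_continuous.
have [c] := compact_EVT_min Om0 Omk cf.
rewrite inE => Oc hc.
have : [set om | Om om /\ forall om', Om om' ->
   qnorm Q (eta - om) <= qnorm Q (eta - om')] (Defs.proj Om Q eta).
  apply: xgetPex; exists c; split => // om' Oom'.
  by rewrite qnorm_le //; apply: hc; rewrite inE.
by case=> Op h; split=> // x Ox; rewrite -qnorm_le //; apply: h.
Qed.

Lemma convex_setP x y (t : R) : 0 <= t -> t <= 1 -> Om x -> Om y ->
  Om (x + t *: (y - x)).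
Proof.
move=> t0 t1 Ox Oy.
have : conv (Itv01 t0 t1) (y : convex_lmodType _) x \in Om.
  by apply: Omc; rewrite inE.
rewrite inE; congr (Om _).
rewrite -[LHS]/(t *: y + (1 - t) *: x) scalerBl scale1r scalerBr.
by rewrite addrCA.
Qed.

(** First-order optimality: moving from the projection towards [x] by a small fraction [t] would
    otherwise decrease the distance. *)
Lemma proj_variational Q eta x : sym_posdef Q -> Om x ->
  bform Q (Defs.proj Om Q eta - eta) (Defs.proj Om Q eta - x) <= 0.
Proof.
move=> hQ Ox; have [] := proj_min eta hQ; set w := Defs.proj _ _ _ => Ow wmin.
rewrite leNgt; apply/negP => B0.
set B := bform _ _ _ in B0; set q := bform Q (w - x) (w - x).
have q0 : 0 <= q by exact: posdef_ge0.
have h t : 0 <= t -> t <= 1 -> 2 * t * B <= t ^+ 2 * q.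
  move=> t0 t1; have := wmin _ (convex_setP t0 t1 Ow Ox).
  have -> : eta - (w + t *: (x - w)) = - ((w - eta) - t *: (w - x)).
    by rewrite !scalerBr; apply/matrixP => i j; rewrite !mxE; ring.
  rewrite -(opprB w eta) /B /q; move: (w - eta) (w - x) => e f.
  by rewrite !bformE (posdefC f e hQ) => ?; lra.
(* The fraction [B / (B + q)] lies in ]0, 1] even when [q = 0], and turns [h] into 2B <= B - tB,
   which is absurd. *)
have Bq : 0 < B + q by rewrite ltr_pwDl.
have t0 : 0 <= B / (B + q) by rewrite divr_ge0 // ltW.
have t1 : B / (B + q) <= 1 by rewrite ler_pdivrMr // mul1r lerDl.
have := h _ t0 t1; set t := B / (B + q).
have tE : t * (B + q) = B by rewrite /t divfK // gt_eqF.
have tp : 0 < t by rewrite /t divr_gt0.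
have -> : t ^+ 2 * q = t * (B - t * B) by rewrite -{1}tE; ring.
have -> : 2 * t * B = t * (2 * B) by ring.
rewrite ler_pM2l //; have : 0 < t * B by rewrite mulr_gt0.
lra.
Qed.

End convex_set.
End projection.

(** The constant [L] of the theorem is a [sup], which dominates its set only when an upper bound
    exists. *)
Lemma compact_enorm_ub (R : realType) (p : nat) (Om : set 'cV[R]_p) :
  Om !=set0 -> compact Om -> has_ubound [set enorm eta | eta in Om].
Proof.
move=> Om0 Omk.
have cf : {within Om, continuous (fun x : 'cV[R]_p => bform 1%:M (0 - x) (0 - x))}.
  by apply: continuous_subspaceT; exact: bform_continuous.
have [c cO hc] := compact_EVT_max Om0 Omk cf.
exists (enorm c) => _ [x Ox <-].
have := hc x; rewrite inE => /(_ Ox).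
rewrite !bform_dotv !mul1mx !sub0r !dotvNr !(dotvC (- _)) !dotvNr !opprK !dotv_enorm.
by rewrite ler_sqr // nnegrE sqrtr_ge0.
Qed.

Lemma bform_sqrB (R : realType) (p : nat) (Q : 'M[R]_p) x y : sym_posdef Q ->
  bform Q (x - y) (x - y) = bform Q x x - 2 * bform Q y x + bform Q y y.
Proof. by move=> hQ; rewrite !bformE (posdefC x y hQ); ring. Qed.

Section fusion.
Context (R : realType) (p : nat) (I : finType).

(** Variance decomposition: [x] is the matrix-weighted mean of the [z j], so the right side exceeds
    the left by the weighted sum of the forms at [z j - x]. *)
Lemma fusion_le (w : I -> R) (S : I -> 'M[R]_p) (z : I -> 'cV[R]_p)
    (x y : 'cV[R]_p) :
  (forall j, 0 <= w j) -> \sum_j w j = 1 -> (forall j, sym_posdef (S j)) ->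
  (\sum_j w j *: S j) *m x = \sum_j w j *: (S j *m z j) ->
  bform (\sum_j w j *: S j) (x - y) (x - y) <=
  \sum_j w j * bform (S j) (z j - y) (z j - y).
Proof.
move=> w0 w1 hS Sx; set Q := \sum_j _.
have hQ : sym_posdef Q by exact: posdef_sum.
have Qx : \sum_j w j * bform (S j) (x - y) (z j - y) = bform Q (x - y) (x - y).
  rewrite [RHS]bform_dotv mulmxBr Sx /Q mulmx_suml -sumrB [RHS]/dotv.
  rewrite mulmx_sumr summxE; apply: eq_bigr => j _.
  by rewrite -scalemxAl -scalerBr -mulmxBr -/(dotv _ _) dotvZr bform_dotv.
have : 0 <= \sum_j w j * bform (S j) ((z j - y) - (x - y)) ((z j - y) - (x - y)).
  by apply: sumr_ge0 => j _; rewrite mulr_ge0 // posdef_ge0.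
under eq_bigr => j _.
  rewrite bform_sqrB // mulrDr mulrBr [w j * (2 * _)]mulrCA.
  over.
rewrite big_split /= sumrB -mulr_sumr Qx -bform_mxsum -/Q; lra.
Qed.

End fusion.

Section eigen.
Import complex.
Context (R : realType) (p : nat).

(** Makes the set in [lambda_max] nonempty. An eigenvalue over the complex numbers exists by
    algebraic closedness, and it is real because [s], the Hermitian form of the real symmetric [Q]
    at the eigenvector, equals its own conjugate. *)
Lemma sym_eigenvalue (Q : 'M[R]_p) : (0 < p)%N -> Q^T = Q ->
  exists a, eigenvalue Q a.
Proof.
move=> p0 sQ; pose f := complex.real_complex R.
have [a] := spectral.eigenvalue_closed (map_mx f Q) p0.
move=> /[dup] ea /eigenvalueP[v vA v0].
pose N : complex.complex R := \sum_i v 0 i * Num.conj (v 0 i).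
have N0 : N != 0.
  rewrite psumr_eq0 => [|i _]; last by rewrite mul_conjC_ge0.
  apply: contra_neqN v0 => /allP h; apply/matrixP => i j; rewrite ord1 mxE.
  by have := h j (mem_index_enum _); rewrite /= mul_conjC_eq0 => /eqP.
pose s := \sum_i (\sum_j v 0 j * f (Q j i)) * Num.conj (v 0 i).
have sE : s = a * N.
  rewrite /s /N mulr_sumr; apply: eq_bigr => i _; rewrite mulrA; congr (_ * _).
  have := congr1 (fun M : 'rV__ => M 0 i) vA; rewrite !mxE => <-.
  by apply: eq_bigr => j _; rewrite mxE.
have fr (r : R) : Num.conj (f r) = f r.
  by apply/CrealP; rewrite complex.complex_real.
have ss : Num.conj s = s.
  rewrite /s rmorph_sum /=; under eq_bigr do rewrite rmorphM rmorph_sum /= conjCK mulr_suml.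
  under [RHS]eq_bigr do rewrite mulr_suml.
  rewrite exchange_big /=; apply: eq_bigr => i _; apply: eq_bigr => j _.
  by rewrite rmorphM /= fr -[in LHS]sQ mxE; ring.
have NN : Num.conj N = N.
  by rewrite /N rmorph_sum /=; apply: eq_bigr => i _; rewrite rmorphM /= conjCK mulrC.
have /CrealP ar : Num.conj a = a.
  by apply: (mulIf N0); rewrite -sE -[in RHS]ss sE rmorphM /= NN.
exists (complex.Re a); rewrite -(eigenvalue_map f).
by rewrite [X in eigenvalue _ X](complex.RRe_real ar).
Qed.

Lemma lambda_max_gt0 (Q : 'M[R]_p) : (0 < p)%N -> sym_posdef Q ->
  0 < lambda_max Q.
Proof.
move=> p0 hQ; have hV := posdef_inv hQ.
(* The trace bound is what lets [sup] dominate each eigenvalue. *)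
have pos a : eigenvalue Q a -> 0 < a <= \tr Q.
  move=> /eigenvalueP[v vQ v0].
  have w0 : v^T != 0 by apply: contra_neq v0 => /(congr1 trmx); rewrite trmxK trmx0.
  have vv : bform Q v^T v^T = a * dotv v^T v^T.
    by rewrite /bform /dotv trmxK vQ -scalemxAl mxE.
  have d0 : 0 < dotv v^T v^T.
    rewrite lt_def dotv_ge0 andbT; apply: contra_neq w0; exact: dotv_eq0.
  have a0 : 0 < a by have := posdef_gt0 hQ w0; rewrite vv pmulr_lgt0.
  rewrite a0 /=; have := posdef_dotv_le v^T hV; rewrite invmxK.
  have -> : bform (invmx Q) v^T v^T = a^-1 * dotv v^T v^T.
    rewrite /bform /dotv trmxK.
    have -> : v *m invmx Q = a^-1 *: v.
      rewrite -[LHS]scale1r -(mulVf (lt0r_neq0 a0)) -scalerA scalemxAl -vQ.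
      by rewrite -mulmxA posdef_mulV // mulmx1.
    by rewrite -scalemxAl mxE.
  by rewrite mulrA ler_pMl // ler_pdivlMr // mul1r.
have [a ea] := sym_eigenvalue p0 (posdef_sym hQ).
apply: lt_le_trans (_ : a <= _); first by have /andP[] := pos _ ea.
apply: ub_le_sup => //; exists (\tr Q) => b /= /pos/andP[] //.
Qed.

End eigen.

(** * One adaptation step *)

(** Expand the [Q']-form at [f = e - d] and bound the cross term in [d] and [e] by the variational
    inequality. The negative terms in [d] are retained for later use. *)
Lemma adapt_energy (R : realType) (p : nat) (Q : 'M[R]_p)
    (phi th thh psi : 'cV[R]_p) (b s : R) :
  sym_posdef Q ->
  let P := invmx Q in
  let Q' := Q + b ^+ 2 *: (phi *m phi^T) in
  let d := psi - thh in
  bform Q' (psi - (thh + (gain b P phi * b * s) *: (P *m phi))) (psi - th) <= 0 ->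
  bform Q' (psi - th) (psi - th) <=
  bform Q (thh - th) (thh - th) + b ^+ 2 * dotv phi (thh - th) ^+ 2
  - b ^+ 2 * dotv phi d ^+ 2 - bform Q d d + 2 * b * s * dotv phi (psi - th).
Proof.
move=> hQ P Q' d; set e := psi - th; set f := thh - th; set c := _ * b * s.
have hP : sym_posdef P by exact: posdef_inv.
have hQ' : sym_posdef Q' by apply: posdef_add_outer => //; exact: sqr_ge0.
have Q'E v : bform Q' v v = bform Q v v + b ^+ 2 * dotv phi v ^+ 2.
  by rewrite bform_mxD bform_mxZ bform_outer -expr2.
have xE : dotv phi (P *m phi) = bform P phi phi by rewrite bform_dotv.
have x0 : 0 <= bform P phi phi by exact: posdef_ge0.
(* The gain is exactly the factor for which [Q'] maps the correction [c *: (P *m phi)] to [b * s]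
   times [phi]. *)
have ce : c * bform Q' (P *m phi) e = b * s * dotv phi e.
  rewrite bform_mxD bform_mxZ bform_outer xE.
  have -> : bform Q (P *m phi) e = dotv phi e.
    by rewrite (posdefC _ _ hQ) bform_dotv mulmxA posdef_mulV // mul1mx dotvC.
  rewrite /c /gain -/(bform P phi phi); field.
  by rewrite gt_eqF // ltr_pwDl // mulr_ge0 // sqr_ge0.
have -> : psi - (thh + c *: (P *m phi)) = d - c *: (P *m phi).
  by rewrite opprD addrA.
rewrite bformDl bformNl bformZl ce => VI.
have fE : f = e - d by rewrite /f /e /d; apply/matrixP => i j; rewrite !mxE; ring.
have : bform Q' (e - d) (e - d) = bform Q f f + b ^+ 2 * dotv phi f ^+ 2.
  by rewrite -fE Q'E.
rewrite (bform_sqrB _ _ hQ') (Q'E d); lra.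
Qed.

Lemma AM_GM_sqr (R : realType) (h q x c : R) : 0 <= q -> 0 <= x -> 0 < c ->
  h ^+ 2 <= x * q -> 2 * `|h| <= c * q + x / c.
Proof.
move=> q0 x0 c0 hh.
have cq : 0 <= c * q by rewrite mulr_ge0 // ltW.
have xc : 0 <= x / c by rewrite divr_ge0 // ltW.
have N0 : 0 <= 2 * `|h| by rewrite mulr_ge0.
have S0 : 0 <= c * q + x / c by rewrite addr_ge0.
rewrite -(ler_pXn2r (isT : (0 < 2)%N) N0 S0) exprMn real_normK ?num_real //.
have := sqr_ge0 (c * q - x / c).
have E : (c * q) * (x / c) = x * q by field; rewrite gt_eqF.
move: (c * q) (x / c) E => u v E; nra.
Qed.

(** Here [q] is the displacement energy, [x] is phi^T P phi, and [s] is drift plus noise. The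
    product s z splits into dr m + nz mc + s (z - m) + nz (m - mc). The drift part leaves b^2 (m -
    mc)^2 - b^2 mc^2, whose first term is cancelled by -b^2 (z - m)^2. Young's inequality charges
    the last two parts to q/2 and q/4, at the cost of 2 and 4 times b^2 x; hence the remaining q/4
    and the constant 6. *)
Lemma adapt_scalar (R : realType) (V V' b m mc z s dr nz q x : R) :
  0 <= x -> 0 <= q -> (z - m) ^+ 2 <= x * q -> (m - mc) ^+ 2 <= (z - m) ^+ 2 ->
  `|s| <= 1 -> `|nz| <= 1 -> s = dr + nz ->
  b * dr * m <= - (b ^+ 2 * (mc * m)) ->
  V' <= V + b ^+ 2 * m ^+ 2 - b ^+ 2 * (z - m) ^+ 2 - q + 2 * b * s * z ->
  V' <= V - b ^+ 2 * mc ^+ 2 - q / 4 + 6 * b ^+ 2 * x + 2 * b * nz * mc.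
Proof.
move=> x0 q0 hzm hmm s1 n1 sE hdr hV.
have bx : 0 <= b ^+ 2 * x by rewrite mulr_ge0 // sqr_ge0.
have h1 : 2 * (b * s * (z - m)) <= 2^-1 * q + 2 * b ^+ 2 * x.
  apply: le_trans (_ : 2 * `|b * (z - m)| <= _).
    rewrite ler_pM2l // mulrAC; apply: le_trans (ler_norm _) _.
    by rewrite normrM ler_piMr.
  have -> : 2 * b ^+ 2 * x = b ^+ 2 * x / 2^-1 by rewrite invrK; ring.
  apply: AM_GM_sqr => //; rewrite exprMn -mulrA.
  by apply: ler_wpM2l => //; exact: sqr_ge0.
have h2 : 2 * (b * nz * (m - mc)) <= 4^-1 * q + 4 * b ^+ 2 * x.
  apply: le_trans (_ : 2 * `|b * (m - mc)| <= _).
    rewrite ler_pM2l // mulrAC; apply: le_trans (ler_norm _) _.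
    by rewrite normrM ler_piMr.
  have -> : 4 * b ^+ 2 * x = b ^+ 2 * x / 4^-1 by rewrite invrK; ring.
  apply: AM_GM_sqr => //; rewrite exprMn -mulrA.
  by apply: ler_wpM2l; [exact: sqr_ge0|exact: le_trans hzm].
have h3 : b ^+ 2 * (m - mc) ^+ 2 <= b ^+ 2 * (z - m) ^+ 2.
  by apply: ler_wpM2l => //; exact: sqr_ge0.
apply: le_trans hV _; rewrite sE in h1 *.
move: (b ^+ 2) hdr h1 h2 h3 bx => b2; nra.
Qed.

Definition clamp (R : realType) (B u : R) : R := Num.max (- B) (Num.min B u).

Section clamp.
Context (R : realType) (B : R).

Lemma clamp_bounds u : 0 <= B -> - B <= clamp B u <= B.
Proof.
move=> B0; rewrite /clamp le_max lexx ge_max ge_min lexx /= andbT; lra. Qed.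

Lemma clamp_id u : - B <= u <= B -> clamp B u = u.
Proof.
by move=> /andP[h1 h2]; rewrite /clamp (min_idPr h2) (max_idPr h1).
Qed.

Lemma clamp_cases u : 0 <= B -> [\/ u <= - B /\ clamp B u = - B,
  - B <= u <= B /\ clamp B u = u | B <= u /\ clamp B u = B].
Proof.
move=> B0; have [h|h] := leP u (- B).
  apply: Or31; split => //; rewrite /clamp.
  by apply/max_idPl; rewrite ge_min h orbT.
have [h'|h'] := leP u B; last first.
  apply: Or33; split; first exact: ltW.
  rewrite /clamp (min_idPl (ltW h')); apply/max_idPr; lra.
have bu : - B <= u <= B by rewrite (ltW h) h'.
by apply: Or32; split; [rewrite (ltW h)|exact: clamp_id].
Qed.

(** [clamp B u] is the point of [-B, B] nearest to [u], and [z] is another point of that interval;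
    [u0] cancels and appears only to match the residuals. *)
Lemma clamp_dist u u0 z : 0 <= B -> - B <= u0 <= B -> - B <= z <= B ->
  ((u - u0) - (clamp B u - u0)) ^+ 2 <= ((z - u0) - (u - u0)) ^+ 2.
Proof.
move=> B0 /andP[? ?] /andP[? ?]; have -> : u - u0 - (clamp B u - u0) = u - clamp B u by ring.
have -> : z - u0 - (u - u0) = z - u by ring.
case: (clamp_cases u B0) => -[h ->].
- have : 0 <= (z + B) * (z - u + (- B - u)) by rewrite mulr_ge0 //; lra.
  nra.
- by rewrite subrr expr0n sqr_ge0.
- have : 0 <= (B - z) * ((u - z) + (u - B)) by rewrite mulr_ge0 //; lra.
  nra.
Qed.

Lemma clamp_drift (C fmin b g : R) (F : R -> R) u u0 : 0 <= B ->
  {homo F : x y / x <= y} ->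
  (forall a c, C - B <= a -> a <= c -> c <= C + B -> fmin * (c - a) <= F c - F a) ->
  0 <= b -> b <= `|g| * fmin -> - B <= u0 <= B ->
  (Num.sg g * b) * (g * (F (C - u) - F (C - u0))) * (u - u0) <=
  - ((Num.sg g * b) ^+ 2 * ((clamp B u - u0) * (u - u0))).
Proof.
move=> B0 Fm Fi b0 bg /andP[l0 r0].
have [g0|g0] := eqVneq g 0.
  by rewrite g0 sgr0 !mul0r expr0n !mul0r oppr0.
have -> : Num.sg g * b * (g * (F (C - u) - F (C - u0))) * (u - u0) =
    b * (`|g| * ((F (C - u) - F (C - u0)) * (u - u0))).
  by rewrite normrEsg; ring.
have -> : (Num.sg g * b) ^+ 2 = b * b by rewrite exprMn sqr_sg g0 mul1r expr2.
rewrite -mulrA -mulrN; apply: ler_wpM2l => //.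
set w := clamp B u - u0.
have wu : 0 <= w * (u - u0).
  have [h|h] := leP u0 u.
    apply: mulr_ge0; last lra.
    rewrite /w; case: (clamp_cases u B0) => -[? ->]; lra.
  apply: mulr_le0; last lra.
  rewrite /w; case: (clamp_cases u B0) => -[? ->]; lra.
apply: le_trans (_ : `|g| * (- (fmin * (w * (u - u0)))) <= _).
  apply: ler_wpM2l => //.
  have /andP[cl cr] := clamp_bounds u B0.
  have [h|h] := leP u0 u.
    have cu : clamp B u <= u.
      case: (clamp_cases u B0) => -[? ->]; lra.
    have uc : u0 <= clamp B u.
      case: (clamp_cases u B0) => -[? ->]; lra.
    have := Fi (C - clamp B u) (C - u0); have := Fm (C - u) (C - clamp B u).
    move=> /(_ ltac:(lra)) H1 /(_ ltac:(lra) ltac:(lra) ltac:(lra)) H2.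
    have : (F (C - u) - F (C - u0)) <= - (fmin * w) by rewrite /w; lra.
    move=> /(ler_wpM2r (ltac:(lra) : 0 <= u - u0)); lra.
  have cu : u <= clamp B u.
    case: (clamp_cases u B0) => -[? ->]; lra.
  have uc : clamp B u <= u0.
    case: (clamp_cases u B0) => -[? ->]; lra.
  have := Fi (C - u0) (C - clamp B u); have := Fm (C - clamp B u) (C - u).
  move=> /(_ ltac:(lra)) H1 /(_ ltac:(lra) ltac:(lra) ltac:(lra)) H2.
  have : - (fmin * w) <= (F (C - u) - F (C - u0)) by rewrite /w; lra.
  move=> /(ler_wpM2r (ltac:(lra) : 0 <= u0 - u)); lra.
rewrite mulrN lerN2 [leRHS]mulrA; exact: ler_wpM2r.
Qed.

End clamp.

(** * Energy along a run *)

Section run.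
Context (R : realType) (n p : nat) (A : 'M[R]_n) (Om : set 'cV[R]_p) (C : R).
Context (pf qf beta : 'I_n -> R) (theta0 : 'I_n -> 'cV[R]_p).
Context (P0 : 'I_n -> 'M[R]_p) (phi : nat -> 'I_n -> 'cV[R]_p).
Context (F : nat -> 'I_n -> R -> R) (s : nat -> 'I_n -> bool).
Context (thetah : nat -> 'I_n -> 'cV[R]_p) (P : nat -> 'I_n -> 'M[R]_p).
Context (psi : nat -> 'I_n -> 'cV[R]_p) (Pbar : nat -> 'I_n -> 'M[R]_p).
Hypothesis hA : weighted_adjacency A.
Hypothesis hP0 : forall i, sym_posdef (P0 i).
Hypothesis run : algorithm_run A Om C pf qf beta theta0 P0 phi F s thetah P psi Pbar.

Definition info k i : 'M[R]_p := invmx (P k i).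

(** The inverse of [Pbar k.+1 i], but written as a rank-one update, from which positive definiteness
    and traces can be read off. *)
Definition info_bar k i : 'M[R]_p :=
  info k i + beta i ^+ 2 *: (phi k i *m (phi k i)^T).

Lemma weight_ge0 i j : 0 <= A i j.
Proof. by case: hA. Qed.

Lemma weight_sum1 i : \sum_j A i j = 1.
Proof. by case: hA. Qed.

Lemma weight_double_sum (f : 'I_n -> R) : \sum_i \sum_j A i j * f j = \sum_j f j.
Proof.
rewrite exchange_big /=; apply: eq_bigr => j _; rewrite -mulr_suml.
have [_ sA _] := hA; under eq_bigr do rewrite sA.
by rewrite weight_sum1 mul1r.
Qed.

Lemma edge_sum (V : lmodType R) i (f : 'I_n -> V) :
  \sum_(j | edge A i j) A i j *: f j = \sum_j A i j *: f j.
Proof.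
rewrite [RHS](bigID (edge A i)) /= [X in _ + X]big1 ?addr0 // => j.
rewrite /edge lt_def weight_ge0 andbT negbK => /eqP ->.
by rewrite scale0r.
Qed.

Lemma invmx_Pbar k i : sym_posdef (P k i) -> invmx (Pbar k.+1 i) = info_bar k i.
Proof.
by move=> hP; rewrite (run_Pbar run) /gain invmx_Sherman_Morrison // sqr_ge0.
Qed.

Lemma run_posdef k i : sym_posdef (P k i).
Proof.
elim: k i => [|k IH] i; first by rewrite (run_P0 run).
(* The recursion fixes only the inverse of [P k.+1 i]; [invmx] is an involution on all matrices,
   singular ones included, so this determines the matrix itself. *)
rewrite -(invmxK (P k.+1 i)) (run_P run) edge_sum; apply: posdef_inv.
apply: posdef_sum => [j||j]; [exact: weight_ge0|exact: weight_sum1|].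
rewrite invmx_Pbar //; apply: posdef_add_outer; first exact: sqr_ge0.
exact: posdef_inv.
Qed.

Lemma info_posdef k i : sym_posdef (info k i).
Proof. exact/posdef_inv/run_posdef. Qed.

Lemma info_bar_posdef k i : sym_posdef (info_bar k i).
Proof. by apply: posdef_add_outer; [exact: sqr_ge0|exact: info_posdef]. Qed.

Lemma infoS k i : info k.+1 i = \sum_j A i j *: info_bar k j.
Proof.
rewrite /info (run_P run) edge_sum; apply: eq_bigr => j _.
by rewrite invmx_Pbar //; exact: run_posdef.
Qed.

Lemma info_thetahS k i :
  info k.+1 i *m thetah k.+1 i = \sum_j A i j *: (info_bar k j *m psi k.+1 j).
Proof.
rewrite (run_theta run) mulmxA posdef_Vmul; last exact: run_posdef.
rewrite mul1mx edge_sum; apply: eq_bigr => j _.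
by rewrite invmx_Pbar //; exact: run_posdef.
Qed.

Lemma trace_info t : \sum_i \tr (info t i) =
  \sum_i \tr (info 0 i) + \sum_(k < t) \sum_i beta i ^+ 2 * enorm (phi k i) ^+ 2.
Proof.
elim: t => [|t IH]; first by rewrite big_ord0 addr0.
rewrite big_ord_recr /= addrA -IH -big_split /=.
under eq_bigr => i _.
  rewrite infoS raddf_sum /=; under eq_bigr do rewrite linearZ /=; over.
rewrite weight_double_sum; apply: eq_bigr => i _.
rewrite raddfD /= mxtraceZ mxtrace_mulC trace_mx11; congr (_ + _ * _).
by rewrite -dotv_enorm.
Qed.

(** A lower bound common to all initial information matrices survives rank-one additions and convex
    averaging. The 1 in [T] keeps it positive for every [n] and [p]. *)
Lemma info_lower_bound : exists2 q0, 0 < q0 &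
  forall k i v, q0 * dotv v v <= bform (info k i) v v.
Proof.
pose T := 1 + \sum_i \tr (P0 i).
have tr0 i : 0 <= \tr (P0 i) by exact: posdef_tr_ge0.
have T0 : 0 < T by rewrite /T ltr_pwDl // sumr_ge0.
exists T^-1; first by rewrite invr_gt0.
elim=> [|k IH] i v.
  rewrite mulrC ler_pdivrMr //.
  have := posdef_dotv_le v (info_posdef 0 i); rewrite /info invmxK (run_P0 run).
  move/le_trans; apply; rewrite mulrC; apply: ler_wpM2l.
    by apply: posdef_ge0; exact: posdef_inv.
  rewrite /T (bigD1 i) //= addrCA lerDl addr_ge0 // sumr_ge0 //.
rewrite infoS bform_mxsum -[leLHS]mul1r -(weight_sum1 i) mulr_suml.
apply: ler_sum => j _; apply: ler_wpM2l; first exact: weight_ge0.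
rewrite bform_mxD bform_mxZ bform_outer -expr2; apply: le_trans (IH j v) _.
by rewrite lerDl mulr_ge0 // sqr_ge0.
Qed.

(** The tangent inequality for ln det at [info_bar k i], where the trace of
    [info k i *m Pbar k.+1 i] is [p] minus the left side. *)
Lemma gain_le_lndet k i :
  beta i ^+ 2 * bform (P k i) (phi k i) (phi k i) /
    (1 + beta i ^+ 2 * bform (P k i) (phi k i) (phi k i)) <=
  ln (\det (info_bar k i)) - ln (\det (info k i)).
Proof.
have hI := info_posdef k i; have hI' := info_bar_posdef k i.
have hP := run_posdef k i.
set x := bform _ _ _; set c := beta i ^+ 2.
have x0 : 0 <= x by exact: posdef_ge0.
have c0 : 0 <= c by exact: sqr_ge0.
have d0 : 1 + c * x != 0 by rewrite gt_eqF // ltr_pwDl // mulr_ge0.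
have := lndetB_le hI hI'.
have -> : invmx (info_bar k i) = Pbar k.+1 i.
  by rewrite -(invmx_Pbar hP) invmxK.
have -> : \tr (info k i *m Pbar k.+1 i) = p%:R - c * x / (1 + c * x).
  rewrite (run_Pbar run) mulmxBr raddfB /= /info posdef_Vmul // mxtrace1.
  congr (_ - _); rewrite -scalemxAr mxtraceZ !mulmxA posdef_Vmul // mul1mx.
  rewrite -mulmxA mxtrace_mulC trace_mx11 -/(bform _ _ _) -/x.
  by rewrite /gain -/(bform _ _ _) -/x -/c; field.
lra.
Qed.

Lemma lndet_info_step k :
  \sum_i (ln (\det (info_bar k i)) - ln (\det (info k i))) <=
  \sum_i ln (\det (info k.+1 i)) - \sum_i ln (\det (info k i)).
Proof.
rewrite sumrB lerD2r -(weight_double_sum (fun j => ln (\det (info_bar k j)))).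
apply: ler_sum => i _; rewrite infoS; apply: lndet_concave => [j||j].
- exact: weight_ge0.
- exact: weight_sum1.
- exact: info_bar_posdef.
Qed.

Section energy.
Hypotheses (hOm0 : Om !=set0) (hOmk : compact Om) (hOmc : convex_set Om).
Context (th : 'cV[R]_p) (B b fmin : R).
Hypothesis hth : Om th.
Hypothesis hB : forall k i v, Om v -> - B <= dotv v (phi k i) <= B.
Hypothesis hb : 0 < b.
Hypothesis hbeta : forall i, beta i = Num.sg (1 - (pf i + qf i)) * b.
Hypothesis hbg : forall i, b <= `|1 - (pf i + qf i)| * fmin.
Hypothesis hpf : forall i, 0 <= pf i < 1.
Hypothesis hqf : forall i, 0 <= qf i < 1.
Hypothesis hF01 : forall k i x, 0 <= F k i x <= 1.
Hypothesis hFm : forall k i, {homo F k i : x y / x <= y}.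
Hypothesis hFi : forall k i a c, C - B <= a -> a <= c -> c <= C + B ->
  fmin * (c - a) <= F k i c - F k i a.

Definition clip k i := clamp B (dotv (thetah k i) (phi k i)) - dotv th (phi k i).

Definition noise k i := (1 - (pf i + qf i)) * F k i (C - dotv th (phi k i))
  + qf i - (s k.+1 i)%:R.

Definition energy k := \sum_i bform (info k i) (thetah k i - th) (thetah k i - th).

(** The expression before the bit is (1 - p) F + q (1 - F), a number in [0, 1]. *)
Lemma bit_residual_le1 k i c (e : bool) :
  `|(1 - (pf i + qf i)) * F k i c + qf i - e%:R| <= 1.
Proof.
have /andP[p0 p1] := hpf i; have /andP[q0 q1] := hqf i.
have /andP[f0 f1] := hF01 k i c; rewrite ler_norml.
have E : (1 - (pf i + qf i)) * F k i c + qf i =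
  (1 - pf i) * F k i c + qf i * (1 - F k i c) by ring.
have E1 : 0 <= (1 - pf i) * F k i c by rewrite mulr_ge0 // subr_ge0 ltW.
have E2 : 0 <= qf i * (1 - F k i c) by rewrite mulr_ge0 // subr_ge0.
have E3 : (1 - pf i) * F k i c <= F k i c by rewrite ler_piMl // gerBl.
have E4 : qf i * (1 - F k i c) <= 1 - F k i c by rewrite ler_piMl ?subr_ge0 // ltW.
rewrite E; case: e => /=; apply/andP; split; lra.
Qed.

Lemma B_ge0 (k : nat) (i : 'I_n) : 0 <= B.
Proof. have /andP[] := hB k i hth; lra. Qed.

Lemma adapt_step k i X : 0 < X ->
  bform (P k i) (phi k i) (phi k i) <= X ->
  bform (info_bar k i) (psi k.+1 i - th) (psi k.+1 i - th) <=
  bform (info k i) (thetah k i - th) (thetah k i - th)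
  - b ^+ 2 * clip k i ^+ 2
  - (dotv (phi k i) (thetah k i - th) - clip k i) ^+ 2 / (4 * X)
  + 6 * b ^+ 2 * bform (P k i) (phi k i) (phi k i)
  + 2 * beta i * noise k i * clip k i.
Proof.
move=> X0 xX; have B0 := B_ge0 k i.
set u := dotv (thetah k i) (phi k i); set u0 := dotv th (phi k i).
set g := 1 - (pf i + qf i).
have g0 : g != 0.
  apply: contraTneq hb => g0; have := hbg i; rewrite -/g g0 normr0 mul0r => ?.
  by rewrite -leNgt.
have b2 : beta i ^+ 2 = b ^+ 2 by rewrite hbeta exprMn sqr_sg -/g g0 mul1r.
have hI := info_posdef k i; have hP := run_posdef k i.
have hE := info_bar_posdef k i.
pose st := g * F k i (C - u) + qf i - (s k.+1 i)%:R.
pose eta := thetah k i + (gain (beta i) (P k i) (phi k i) * beta i * st) *: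
  (P k i *m phi k i).
have psiE : psi k.+1 i = Defs.proj Om (info_bar k i) eta.
  by rewrite (run_psi run) invmx_Pbar.
have PI : P k i = invmx (info k i) by rewrite /info invmxK.
have VI : bform (info_bar k i) (psi k.+1 i - eta) (psi k.+1 i - th) <= 0.
  by rewrite psiE; exact: proj_variational.
have [Ops _] := proj_min hOm0 hOmk eta hE; rewrite -psiE in Ops.
rewrite /eta PI in VI; have := adapt_energy hI VI; rewrite -/(info_bar k i).
have mE : dotv (phi k i) (thetah k i - th) = u - u0.
  by rewrite dotvBr /u /u0 !(dotvC (phi k i)).
set z := dotv (psi k.+1 i) (phi k i).
have zE : dotv (phi k i) (psi k.+1 i - th) = z - u0.
  by rewrite dotvBr /z /u0 !(dotvC (phi k i)).
set d := psi k.+1 i - thetah k i.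
have dE : dotv (phi k i) d = z - u0 - (u - u0).
  by rewrite /d dotvBr /z /u !(dotvC (phi k i)); ring.
rewrite mE zE dE b2; set q := bform (info k i) d d => hV.
have q0 : 0 <= q by exact: posdef_ge0.
set x := bform _ _ _ in xX *.
have x0 : 0 <= x by exact: posdef_ge0.
have hx : (z - u0 - (u - u0)) ^+ 2 <= x * q.
  have -> : q = bform (P k i) (info k i *m d) (info k i *m d).
    by rewrite [RHS]bform_dotv mulmxA posdef_mulV // mul1mx dotvC -bform_dotv.
  rewrite -dE; have -> : dotv (phi k i) d = bform (P k i) (phi k i) (info k i *m d).
    by rewrite bform_dotv mulmxA posdef_mulV // mul1mx.
  exact: posdef_CauchySchwarz.
have hu0 := hB k i hth; have hz := hB k i Ops.
have hc := clamp_dist u B0 hu0 hz; rewrite -/(clip k i) in hc.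
have hst : `|st| <= 1 by exact: bit_residual_le1.
have hn : `|noise k i| <= 1 by exact: bit_residual_le1.
have hdr := clamp_drift u B0 (@hFm k i) (@hFi k i) (ltW hb) (hbg i) hu0.
rewrite -/g -hbeta -/(clip k i) b2 in hdr.
have sE : st = g * (F k i (C - u) - F k i (C - u0)) + noise k i.
  by rewrite /st /noise -/g; ring.
have b2' : b ^+ 2 = beta i ^+ 2 by rewrite b2.
rewrite b2' in hdr hV.
have := adapt_scalar x0 q0 hx hc hst hn sE hdr hV; rewrite b2.
(* The quarter of the displacement energy left by [adapt_scalar] pays for the clipping gap, whose
   square is at most [x * q], hence at most [X * q]. *)
have : (u - u0 - clip k i) ^+ 2 / (4 * X) <= q / 4.
  rewrite ler_pdivrMr ?mulr_gt0 //; apply: le_trans hc _; apply: le_trans hx _.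
  have := ler_wpM2r q0 xX; lra.
by lra.
Qed.

Lemma energyS_le k : energy k.+1 <=
  \sum_i bform (info_bar k i) (psi k.+1 i - th) (psi k.+1 i - th).
Proof.
rewrite -(weight_double_sum (fun i => bform _ (psi k.+1 i - th) _)).
apply: ler_sum => i _; rewrite infoS; apply: fusion_le => [j||j|].
- exact: weight_ge0.
- exact: weight_sum1.
- exact: info_bar_posdef.
- by rewrite -infoS info_thetahS.
Qed.

(** With v = P phi, both q0 |v|^2 <= x and x^2 <= |phi|^2 |v|^2 hold, so x <= M^2 / q0. The added 1
    makes the bound positive even for M = 0. *)
Lemma regressor_quad_bound (M : R) : (forall k i, enorm (phi k i) <= M) ->
  exists2 X, 0 < X & forall k i, bform (P k i) (phi k i) (phi k i) <= X.
Proof.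
move=> hM; have [q0 q0p hq] := info_lower_bound.
exists (M ^+ 2 / q0 + 1).
  by rewrite ltr_wpDl // divr_ge0 ?sqr_ge0 // ltW.
move=> k i; have hP := run_posdef k i; set x := bform _ _ _.
set v := P k i *m phi k i.
have xv : bform (info k i) v v = x.
  by rewrite bform_dotv /v mulmxA posdef_Vmul // mul1mx dotvC -bform_dotv.
have : q0 * dotv v v <= x by rewrite -xv; exact: hq.
have x0 : 0 <= x by exact: posdef_ge0.
have cs : x ^+ 2 <= dotv (phi k i) (phi k i) * dotv v v.
  by rewrite /x bform_dotv; exact: dotv_CauchySchwarz.
have pM : dotv (phi k i) (phi k i) <= M ^+ 2.
  rewrite dotv_enorm ler_sqr ?nnegrE ?sqrtr_ge0 //.
  exact: le_trans (sqrtr_ge0 _) (hM k i).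
have d0 := dotv_ge0 v.
move=> qx; suff : x <= M ^+ 2 / q0 by lra.
rewrite ler_pdivlMr //; have [->|xn0] := eqVneq x 0.
  by rewrite mul0r sqr_ge0.
have xp : 0 < x by rewrite lt_def xn0.
rewrite -(ler_pM2l xp) mulrA -expr2.
apply: le_trans (_ : M ^+ 2 * dotv v v * q0 <= _).
  apply: ler_wpM2r; first exact: ltW.
  by apply: le_trans cs _; apply: ler_wpM2r.
by rewrite -mulrA (mulrC x) (mulrC _ q0); apply: ler_wpM2l => //; exact: sqr_ge0.
Qed.

Lemma energy_bound (M : R) (K : 'I_n -> R) :
  (forall k i, enorm (phi k i) <= M) ->
  (forall t i, \sum_(k < t) 2 * beta i * noise k i * clip k i <=
     b ^+ 2 / 2 * (\sum_(k < t) clip k i ^+ 2) + K i) ->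
  exists c K1 K2 T0, [/\ 0 < c, 0 <= K2, 0 <= T0 & forall t r,
    \sum_(k < t) \sum_i enorm (phi k i) ^+ 2 <= r ->
    c * (\sum_(k < t) \sum_i dotv (phi k i) (thetah k i - th) ^+ 2) + energy t <=
    K1 + K2 * ln (T0 + b ^+ 2 * r)].
Proof.
move=> hM hK; have [X X0 hX] := regressor_quad_bound hM.
(* [c1] is the half of the coefficient of [clip ^+ 2] that [hK] does not consume; [c2] is the
   coefficient of the squared gap in [adapt_step]. Halving their minimum in [c] accounts for m^2 <=
   2 mc^2 + 2 (m - mc)^2. *)
pose c1 := b ^+ 2 / 2; pose c2 := (4 * X)^-1.
have b20 : 0 < b ^+ 2 by rewrite exprn_gt0.
have c10 : 0 < c1 by rewrite /c1 divr_gt0.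
have c20 : 0 < c2 by rewrite /c2 invr_gt0 mulr_gt0.
pose c := Num.min c1 c2 / 2.
pose D k := \sum_i ln (\det (info k i)).
pose T0 := \sum_i \tr (info 0 i).
have g0 i : 1 - (pf i + qf i) != 0.
  apply: contraTneq hb => g0; have := hbg i; rewrite g0 normr0 mul0r => ?.
  by rewrite -leNgt.
have b2 i : beta i ^+ 2 = b ^+ 2 by rewrite hbeta exprMn sqr_sg g0 mul1r.
(* Since b^2 x is at most b^2 X, the factor 1 + b^2 X compensates the denominator in
   [gain_le_lndet]; the 6 comes from [adapt_step]. *)
pose KX := 6 * (1 + b ^+ 2 * X).
have bX0 : 0 <= b ^+ 2 * X by rewrite mulr_ge0 // ltW.
have KX0 : 0 < KX by rewrite mulr_gt0 // ltr_pwDl.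
have step k : energy k.+1 + \sum_i (b ^+ 2 * clip k i ^+ 2 +
    c2 * (dotv (phi k i) (thetah k i - th) - clip k i) ^+ 2) <=
    energy k + KX * (D k.+1 - D k) + \sum_i 2 * beta i * noise k i * clip k i.
  rewrite -lerBrDr; apply: le_trans (energyS_le k) _.
  apply: (@le_trans _ _ (energy k + KX * (\sum_i (ln (\det (info_bar k i)) -
    ln (\det (info k i)))) + \sum_i 2 * beta i * noise k i * clip k i -
    \sum_i (b ^+ 2 * clip k i ^+ 2 +
    c2 * (dotv (phi k i) (thetah k i - th) - clip k i) ^+ 2))); last first.
    rewrite lerD2r lerD2r lerD2l ler_pM2l //; exact: lndet_info_step.
  rewrite /energy mulr_sumr -!big_split /= -sumrB; apply: ler_sum => i _.
  have := adapt_step X0 (hX k i); set V := bform (info_bar k i) _ _.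
  have := gain_le_lndet k i; rewrite b2; set x := bform (P k i) _ _.
  set L := ln _ - ln _ => hL.
  have x0 : 0 <= x by apply: posdef_ge0; exact: run_posdef.
  have bx0 : 0 <= b ^+ 2 * x by rewrite mulr_ge0 // ltW.
  have bxX : b ^+ 2 * x <= b ^+ 2 * X by rewrite ler_pM2l //; exact: hX.
  have : 6 * b ^+ 2 * x <= KX * L.
    apply: (@le_trans _ _ (KX * (b ^+ 2 * x / (1 + b ^+ 2 * x)))); last first.
      by rewrite ler_pM2l.
    rewrite -[leLHS]mulrA /KX -[leRHS]mulrA ler_pM2l //.
    move: (b ^+ 2 * x) (b ^+ 2 * X) bx0 bxX => y Y y0 yY.
    rewrite mulrA ler_pdivlMr ?ltr_pwDl // mulrC; apply: ler_wpM2r => //; lra.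
  rewrite -/c2; lra.
have total t : energy t + \sum_(k < t) \sum_i (b ^+ 2 * clip k i ^+ 2 +
    c2 * (dotv (phi k i) (thetah k i - th) - clip k i) ^+ 2) <=
    energy 0 + KX * (D t - D 0) +
    \sum_(k < t) \sum_i 2 * beta i * noise k i * clip k i.
  elim: t => [|t IH]; first by rewrite !big_ord0 subrr mulr0 !addr0.
  rewrite !big_ord_recr /=; have := step t.
  set S1 := \sum_i _ in IH *; set S2 := \sum_(k < t) _ in IH *.
  lra.
exists c, (energy 0 - KX * D 0 + \sum_i K i), (KX * (n%:R * p%:R)), T0; split.
- by rewrite /c divr_gt0 // lt_min c10 c20.
- by apply: mulr_ge0; [exact: ltW|rewrite mulr_ge0].
- by apply: sumr_ge0 => i _; apply: posdef_tr_ge0; exact: info_posdef.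
move=> t r hr.
have Dt : D t <= n%:R * p%:R * ln (T0 + b ^+ 2 * r).
  have trt : \sum_i \tr (info t i) <= T0 + b ^+ 2 * r.
    rewrite trace_info lerD2l -[leLHS](_ : b ^+ 2 * (\sum_(k < t) \sum_i enorm (phi k i) ^+ 2) = _).
      by rewrite ler_pM2l.
    rewrite mulr_sumr; apply: eq_bigr => k _; rewrite mulr_sumr.
    by apply: eq_bigr => i _; rewrite b2.
  apply: le_trans (_ : \sum_(i < n) p%:R * ln (T0 + b ^+ 2 * r) <= _).
    apply: ler_sum => i _; apply: lndet_le_lntr; first exact: info_posdef.
    apply: le_trans trt; rewrite (bigD1 i) //= lerDl sumr_ge0 // => j _.
    by apply: posdef_tr_ge0; exact: info_posdef.
  by rewrite sumr_const card_ord -[leLHS]mulr_natl mulrA.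
have := total t; rewrite exchange_big /= [X in _ <= _ + X]exchange_big /=.
rewrite [X in c * X]exchange_big /= => htot.
have hmart : \sum_i \sum_(k < t) 2 * beta i * noise k i * clip k i <=
    \sum_i (c1 * (\sum_(k < t) clip k i ^+ 2)) + \sum_i K i.
  by rewrite -big_split /=; apply: ler_sum => i _; exact: hK.
have hc : c * (\sum_i \sum_(k < t) dotv (phi k i) (thetah k i - th) ^+ 2) +
    \sum_i (c1 * (\sum_(k < t) clip k i ^+ 2)) <=
    \sum_i \sum_(k < t) (b ^+ 2 * clip k i ^+ 2 +
    c2 * (dotv (phi k i) (thetah k i - th) - clip k i) ^+ 2).
  rewrite mulr_sumr -big_split /=; apply: ler_sum => i _.
  rewrite !mulr_sumr -big_split /=; apply: ler_sum => k _.
  move: (dotv _ _) (clip _ _) => m mc.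
  have cc1 : c * 2 <= c1 by rewrite /c divfK // ge_min lexx.
  have cc2 : c * 2 <= c2 by rewrite /c divfK // ge_min lexx orbT.
  have h1 := ler_wpM2r (sqr_ge0 mc) cc1.
  have h2 := ler_wpM2r (sqr_ge0 (m - mc)) cc2.
  have c0 : 0 <= c by rewrite /c divr_ge0 // le_min !ltW.
  have h3 : c * m ^+ 2 <= c * (2 * mc ^+ 2 + 2 * (m - mc) ^+ 2).
    apply: ler_wpM2l => //; have := sqr_ge0 (m - 2 * mc); lra.
  have h4 : b ^+ 2 = c1 + c1 by rewrite /c1; field.
  rewrite h4; lra.
have := ler_wpM2l (ltW KX0) Dt; lra.
Qed.

End energy.
End run.

(** * Substituting a random threshold *)

Section discretisation.
Context (R : realType).

(** Floor plus one instead of a ceiling: the value lies strictly above [c] for every [c], as a limit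
    from the right demands. *)
Definition disc (n : nat) (c : R) : R :=
  (Num.floor (c * n.+1%:R) + 1)%:~R / n.+1%:R.

Lemma disc_itv n c : c < disc n c <= c + n.+1%:R^-1.
Proof.
have n0 : 0 < n.+1%:R :> R by rewrite ltr0n.
have /andP[h1 h2] := floor_itv (c * n.+1%:R).
rewrite /disc ltr_pdivlMr // h2 /= ler_pdivrMr // mulrDl mulVf ?gt_eqF //.
by rewrite intrD lerD2r.
Qed.

Lemma disc_fibreE n c0 : [set c : R | Num.floor (c * n.+1%:R) = Num.floor (c0 * n.+1%:R)] =
  `[(Num.floor (c0 * n.+1%:R))%:~R / n.+1%:R, disc n c0[%classic.
Proof.
have n0 : 0 < n.+1%:R :> R by rewrite ltr0n.
apply/seteqP; split => c /=; rewrite in_itv /= /disc ler_pdivrMr // ltr_pdivlMr //.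
  by move/eqP; rewrite floor_eq.
by rewrite -floor_eq => /eqP.
Qed.

Lemma disc_cvg (c : R) : disc n c @[n --> \oo] --> c.
Proof.
apply: (@squeeze_cvgr _ _ _ _ (fun=> c) (fun n => c + n.+1%:R^-1)).
- by apply: nearW => n; have /andP[/ltW -> ->] := disc_itv n c.
- exact: cvg_cst.
- rewrite -[X in _ --> X]addr0; apply: cvgD; first exact: cvg_cst.
  exact: cvg_harmonic.
Qed.

End discretisation.

(* [X] is approximated from the right by the countably valued [disc n X], on
   whose fibres [H x (X x)] has a constant second argument. *)
Section substitution.
Context d (T : measurableType d) (R : realType) (P : probability T R).
Context (gen : set (set T)).
Hypothesis hG : <<s gen>> `<=` @measurable d T.
Context (X : T -> R) (H : T -> R -> R) (K : R).
Hypothesis hX : measurable_wrt (<<s gen>>) X.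
Hypothesis hHm : forall c, measurable_fun [set: T] (H ^~ c).
Hypothesis hH0 : forall c A, <<s gen>> A -> (\int[P]_(x in A) (H x c)%:E = 0)%E.
Hypothesis hHK : forall x c, X x <= c <= X x + 1 -> `|H x c| <= K.
Hypothesis hHr : forall x, H x c @[c --> (X x)^'+] --> H x (X x).

(** The fibres of [disc n] along [X], numbered by naturals through [pickle] so that they form a
    countable partition. *)
Let E n m := [set x | pickle (Num.floor (X x * n.+1%:R)) = m].

Let E_G n m : <<s gen>> (E n m).
Proof.
apply: hX; exists [set c : R | pickle (Num.floor (c * n.+1%:R)) = m]; last first.
  by rewrite setTI.
have [[c0 <-]|] := pselect ([set c : R | pickle (Num.floor (c * n.+1%:R)) = m] !=set0).
  rewrite (_ : mkset _ = [set c : R | Num.floor (c * n.+1%:R) = Num.floor (c0 * n.+1%:R)]).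
    by rewrite disc_fibreE.
  apply/seteqP; split => c /=; last by move->.
  by move/(pcan_inj pickleK).
by move=> /set0P/negP/negbNE/eqP ->.
Qed.

Let H_disc n m x0 x : E n m x0 -> E n m x -> disc n (X x) = disc n (X x0).
Proof. by move=> <- /(pcan_inj pickleK) h; rewrite /disc h. Qed.

Let E_cover n : \bigcup_m E n m = [set: T].
Proof. by apply/seteqP; split => // x _; exists (pickle (Num.floor (X x * n.+1%:R))). Qed.

Let E_triv n : trivIset [set: nat] (E n).
Proof.
apply/trivIsetP => i j _ _ ij; apply/seteqP; split => // x [h1 h2].
by case/eqP: ij; rewrite -h1 -h2.
Qed.

Let disc_meas n : measurable_fun [set: T] (fun x => H x (disc n (X x))).
Proof.
rewrite -(E_cover n); apply/measurable_fun_bigcup => [m|m]; first exact: hG (E_G n m).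
have [[x0 h0]|] := pselect (E n m !=set0); last first.
  by move=> /set0P/negP/negbNE/eqP ->; exact: measurable_fun_set0.
apply: (@eq_measurable_fun _ _ _ _ _ (H ^~ (disc n (X x0)))).
  by move=> x; rewrite inE => hx; rewrite (H_disc h0 hx).
exact: measurable_funS (hHm _).
Qed.

(** [disc n (X x)] exceeds [X x] by at most 1, so [hHK] asks for a bound on that range only; this
    admits kernels linear in the second argument. *)
Let bound n x : `|H x (disc n (X x))| <= K.
Proof.
apply: hHK; have /andP[/ltW -> /= h] := disc_itv n (X x).
by apply: le_trans h _; rewrite lerD2l invf_le1 // ler1n.
Qed.

Let limit x : H x (disc n (X x)) @[n --> \oo] --> H x (X x).
Proof.
have /cvg_at_rightP := @hHr x; apply; split; last exact: disc_cvg.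
by move=> n; have /andP[] := disc_itv n (X x).
Qed.

Let int_disc n A : <<s gen>> A ->
  (\int[P]_(x in A) (H x (disc n (X x)))%:E = 0)%E.
Proof.
move=> GA; have GI m : <<s gen>> (A `&` E n m).
  exact: (@measurableI _ (g_sigma_algebraType gen) A (E n m) GA (E_G n m)).
have AE : A = \bigcup_m (A `&` E n m) by rewrite -setI_bigcupr E_cover setIT.
rewrite AE integral_bigcup.
(* On each fibre the second argument is a constant, and the fibre cut with [A] stays in the
   sub-sigma-algebra, so [hH0] annihilates every term. *)
- apply: eseries0 => m _ _.
  have [[x0 [_ h0]]|] := pselect ((A `&` E n m) !=set0); last first.
    by move=> /set0P/negP/negbNE/eqP ->; rewrite integral_set0.
  rewrite -[RHS](hH0 (disc n (X x0)) (GI m)); apply: eq_integral => x.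
  by rewrite inE => -[_ hx]; rewrite (H_disc h0 hx).
- by apply: trivIset_setIl; exact: E_triv.
- by move=> m; exact: hG (GI m).
rewrite -AE; apply: measurable_bounded_integrable; first exact: hG.
- by rewrite (le_lt_trans (probability_le1 _ (hG GA))) // ltry.
- exact: measurable_funS (disc_meas n).
- exists K; split; first exact: num_real.
  by move=> K' KK' x _ /=; apply: le_trans (bound n x) (ltW KK').
Qed.

Lemma measurable_substitution : measurable_fun [set: T] (fun x => H x (X x)).
Proof.
apply: (@measurable_fun_cvg _ _ _ _ (fun n x => H x (disc n (X x)))).
  exact: disc_meas.
by move=> x _; exact: limit.
Qed.

Lemma integral_substitution A : <<s gen>> A ->
  (\int[P]_(x in A) (H x (X x))%:E = 0)%E.
Proof.
move=> GA; have mA := hG GA.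
have [] := @dominated_convergence _ T R P A mA
  (fun n x => (H x (disc n (X x)))%:E) (fun x => (H x (X x))%:E) (cst K%:E).
- move=> n; apply/measurable_EFinP; exact: measurable_funS (disc_meas n).
- apply/measurable_EFinP; exact: measurable_funS measurable_substitution.
- by apply: aeW => x _; apply/fine_cvgP; split; [exact: nearW|exact: limit].
- apply: (@measurable_bounded_integrable _ _ _ P (cst K)) => //.
    by rewrite (le_lt_trans (probability_le1 _ mA)) // ltry.
  exists `|K|; split; first exact: num_real.
  by move=> K' KK' x _ /=; exact: ltW.
- by apply: aeW => x n _; rewrite /= lee_fin.
move=> _ _; under eq_fun do rewrite int_disc //.
by move=> /(cvg_unique (@ereal_hausdorff R)); apply; exact: cvg_cst.
Qed.

End substitution.

(** * Measurability of matrix-valued maps *)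

Section matrix_measurability.
Context d (T : measurableType d) (R : realType).

Definition mx_measurable m n (f : T -> 'M[R]_(m, n)) :=
  forall i j, measurable_fun [set: T] (fun x => f x i j).

Lemma mx_measurableD m n (f g : T -> 'M[R]_(m, n)) :
  mx_measurable f -> mx_measurable g -> mx_measurable (fun x => f x + g x).
Proof.
move=> hf hg i j; under eq_fun do rewrite mxE.
exact: measurable_funD.
Qed.

Lemma mx_measurable_cst m n (M : 'M[R]_(m, n)) : mx_measurable (fun=> M).
Proof. by move=> i j; exact: measurable_cst. Qed.

Lemma mx_measurableZ m n (a : T -> R) (f : T -> 'M[R]_(m, n)) :
  measurable_fun [set: T] a -> mx_measurable f ->
  mx_measurable (fun x => a x *: f x).
Proof.
move=> ha hf i j; under eq_fun do rewrite mxE.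
exact: measurable_funM.
Qed.

Lemma mx_measurableN m n (f : T -> 'M[R]_(m, n)) :
  mx_measurable f -> mx_measurable (fun x => - f x).
Proof.
move=> hf; under eq_fun do rewrite -scaleN1r.
exact: mx_measurableZ.
Qed.

Lemma mx_measurableB m n (f g : T -> 'M[R]_(m, n)) :
  mx_measurable f -> mx_measurable g -> mx_measurable (fun x => f x - g x).
Proof. by move=> hf hg; apply: mx_measurableD => //; exact: mx_measurableN. Qed.

Lemma mx_measurable_sum m n (I : Type) (r : seq I) (Q : pred I)
    (f : I -> T -> 'M[R]_(m, n)) :
  (forall i, mx_measurable (f i)) -> mx_measurable (fun x => \sum_(i <- r | Q i) f i x).
Proof.
move=> hf i j; under eq_fun do rewrite summxE.
under eq_fun do rewrite -big_filter.
by apply: measurable_sum => k; exact: hf.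
Qed.

Lemma mx_measurable_tr m n (f : T -> 'M[R]_(m, n)) :
  mx_measurable f -> mx_measurable (fun x => (f x)^T).
Proof. by move=> hf i j; under eq_fun do rewrite mxE; exact: hf. Qed.

Lemma mx_measurableM m n l (f : T -> 'M[R]_(m, n)) (g : T -> 'M[R]_(n, l)) :
  mx_measurable f -> mx_measurable g -> mx_measurable (fun x => f x *m g x).
Proof.
move=> hf hg i j; under eq_fun do rewrite mxE.
by apply: measurable_sum => k; exact: measurable_funM.
Qed.

Lemma measurable_det n (f : T -> 'M[R]_n) :
  mx_measurable f -> measurable_fun [set: T] (fun x => \det (f x)).
Proof.
move=> hf; apply: measurable_sum => s; apply: measurable_funM; first exact: measurable_cst.
by apply: measurable_prod => i _; exact: hf.
Qed.

Lemma measurable_inv_gt0 (f : T -> R) : (forall x, 0 < f x) ->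
  measurable_fun [set: T] f -> measurable_fun [set: T] (fun x => (f x)^-1).
Proof.
move=> f0 hf; rewrite (_ : (fun x => (f x)^-1) = (fun x => expR (- 1 * ln (f x)))).
  apply: measurableT_comp; first exact: measurable_expR.
  apply: measurable_funM; first exact: measurable_cst.
  by apply: measurableT_comp => //; exact: measurable_ln.
by apply/funext => x; rewrite mulN1r expRN lnK ?posrE.
Qed.

Lemma mx_measurable_inv n (f : T -> 'M[R]_n) : (forall x, sym_posdef (f x)) ->
  mx_measurable f -> mx_measurable (fun x => invmx (f x)).
Proof.
move=> f0 hf i j.
rewrite (_ : (fun x => _) = (fun x => (\det (f x))^-1 * cofactor (f x) j i)); last first.
  by apply/funext => x; rewrite /invmx posdef_unit // !mxE.
apply: measurable_funM.
  apply: measurable_inv_gt0; last exact: measurable_det.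
  by move=> x; exact: posdef_det_gt0.
apply: measurable_funM; first exact: measurable_cst.
apply: measurable_det => k l; under eq_fun do rewrite !mxE.
exact: hf.
Qed.

Lemma measurable_bform n (Q : T -> 'M[R]_n) (y z : T -> 'cV[R]_n) :
  mx_measurable Q -> mx_measurable y -> mx_measurable z ->
  measurable_fun [set: T] (fun x => bform (Q x) (y x) (z x)).
Proof.
move=> hQ hy hz; apply: (mx_measurableM _ hz 0 0).
by apply: mx_measurableM => //; exact: mx_measurable_tr.
Qed.

Lemma measurable_dotv n (y z : T -> 'cV[R]_n) :
  mx_measurable y -> mx_measurable z ->
  measurable_fun [set: T] (fun x => dotv (y x) (z x)).
Proof.
by move=> hy hz; apply: (mx_measurableM _ hz 0 0); exact: mx_measurable_tr.
Qed.

Lemma measurable_nat_fibres (N : T -> nat) :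
  (forall k, measurable [set x | N x = k]) ->
  forall g : nat -> R, measurable_fun [set: T] (fun x => g (N x)).
Proof.
move=> hN g _ Y mY; rewrite setTI.
rewrite (_ : _ @^-1` Y = \bigcup_(k in g @^-1` Y) [set x | N x = k]).
  exact: bigcup_measurable.
apply/seteqP; split => [x Yx|x [k Yk /= Nk]]; first by exists (N x).
by rewrite /= Nk.
Qed.

End matrix_measurability.

(** Rational points near [Om] need not belong to it, so every rational box that meets [Om]
    contributes one chosen representative. *)
Lemma countable_dense (R : realType) (p : nat) (Om : set 'cV[R]_p) :
  Om !=set0 -> exists w : nat -> 'cV[R]_p, (forall k, Om (w k)) /\
  forall om (e : R), Om om -> 0 < e ->
    exists k, forall i, `|w k i 0 - om i 0| < e.
Proof.
case=> o0 Oo0.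
pose close (z : 'cV[rat]_p) (m : nat) : set 'cV[R]_p :=
  [set om | Om om /\ forall i, `|om i 0 - ratr (z i 0)| < m.+1%:R^-1].
pose w k : 'cV[R]_p := if unpickle k is Some (z, m) then
   xget o0 (close z m) else o0.
exists w; split.
  move=> k; rewrite /w; case: unpickle => [[z m]|//].
  by case: xgetP => [y -> []|].
move=> om e Oom e0.
have [m hm] : exists m : nat, m.+1%:R^-1 < e / 2.
  have /archi_boundP := ltW (divr_gt0 (ltr0Sn R 1) e0).
  set m := Num.bound _ => hm; exists m.
  rewrite invf_plt ?posrE ?ltr0n ?divr_gt0 // invf_div; apply: lt_trans hm _.
  by rewrite ltr_nat.
have hq i : exists q : rat, `|om i 0 - ratr q| < m.+1%:R^-1.
  have [] := @rat_in_itvoo R (om i 0 - m.+1%:R^-1) (om i 0 + m.+1%:R^-1).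
    by rewrite ltrBlDr -addrA ltrDl addr_gt0 // invr_gt0 ltr0n.
  by move=> q; rewrite in_itv /= => /andP[h1 h2]; exists q; rewrite distrC ltr_distl h1 h2.
have [z hz] : exists z : 'cV[rat]_p, forall i, `|om i 0 - ratr (z i 0)| < m.+1%:R^-1.
  exists (\col_i xget 0 [set q | `|om i 0 - ratr q| < m.+1%:R^-1]) => i.
  rewrite mxE.
  exact: (@xgetPex _ 0 [set q | `|om i 0 - ratr q| < m.+1%:R^-1] (hq i)).
exists (pickle (z, m)) => i; rewrite /w pickleK.
have [_ h] : close z m (xget o0 (close z m)) by apply: xgetPex; exists om.
apply: le_lt_trans (ler_distD (ratr (z i 0)) _ _) _.
rewrite (splitr e) [X in _ + X]distrC.
by apply: ltrD; apply: lt_trans hm; [exact: h|exact: hz].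
Qed.

Section proj_measurability.
Context (R : realType) (p : nat) (Om : set 'cV[R]_p) (Om0 : Om !=set0)
  (Omk : compact Om) (Omc : convex_set Om).
Context d (T : measurableType d) (Q : T -> 'M[R]_p) (eta : T -> 'cV[R]_p).
Hypothesis Q0 : forall x, sym_posdef (Q x).
Hypothesis Qm : mx_measurable Q.
Hypothesis etam : mx_measurable eta.

Lemma bform_dense (w : nat -> 'cV[R]_p) (A : 'M[R]_p) y om (e : R) :
  (forall om e, Om om -> 0 < e -> exists k, forall i, `|w k i 0 - om i 0| < e) ->
  Om om -> 0 < e ->
  exists k, bform A (y - w k) (y - w k) < bform A (y - om) (y - om) + e.
Proof.
move=> hw Oom e0.
have /cvgr_dist_lt/(_ e e0) := @bform_continuous R p A y om.
rewrite near_simpl => /nbhs_ballP[r /= r0 hr].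
have [k hk] := hw om r Oom r0; exists k.
have : ball om r (w k).
  by split=> // i j; rewrite ord1 /ball /= distrC; exact: hk.
move=> /hr /=; rewrite ltr_norml => /andP[h1 h2]; lra.
Qed.

(** Quadratic growth at the minimiser: by the variational inequality an excess of at most [e] in the
    objective bounds the form at [b - a] by [e], so near-minimisers are close to the projection. *)
Lemma proj_sharp x b (e : R) : Om b ->
  bform (Q x) (eta x - b) (eta x - b) <=
  bform (Q x) (eta x - Defs.proj Om (Q x) (eta x)) (eta x - Defs.proj Om (Q x) (eta x)) + e ->
  forall i, (b i 0 - Defs.proj Om (Q x) (eta x) i 0) ^+ 2 <= \tr (invmx (Q x)) * e.
Proof.
move=> Ob; have := proj_variational Om0 Omk Omc (eta x) (Q0 x) Ob.
set a := Defs.proj _ _ _ => VI hb i.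
have ab : bform (Q x) (b - a) (b - a) <= e.
  have E1 : eta x - b = - (a - eta x) - (b - a) by apply/matrixP => k l; rewrite !mxE; ring.
  have E2 : a - b = - (b - a) by rewrite opprB.
  have E3 : eta x - a = - (a - eta x) by rewrite opprB.
  move: hb VI; rewrite E1 E2 E3; move: (a - eta x) (b - a) => f g.
  by rewrite !bformE (posdefC g f (Q0 x)); lra.
apply: le_trans (_ : dotv (b - a) (b - a) <= _).
  rewrite dotvE (bigD1 i) //= !mxE expr2 lerDl sumr_ge0 // => k _.
  by rewrite -expr2 sqr_ge0.
apply: le_trans (posdef_dotv_le _ (Q0 x)) _.
by apply: ler_wpM2l => //; apply: posdef_tr_ge0; exact: posdef_inv.
Qed.

Lemma mx_measurable_proj : mx_measurable (fun x => Defs.proj Om (Q x) (eta x)).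
Proof.
have [w [Ow wd]] := countable_dense Om0.
pose q k x := bform (Q x) (eta x - w k) (eta x - w k).
(* Near-minimality is tested against the dense sequence alone, so [good] is a countable intersection
   of measurable comparisons. *)
pose good (m k : nat) x := `[< forall k', q k x <= q k' x + m.+1%:R^-1 >].
pose v x := bform (Q x) (eta x - Defs.proj Om (Q x) (eta x)) (eta x - Defs.proj Om (Q x) (eta x)).
have m0 (m : nat) : 0 < m.+1%:R^-1 :> R by rewrite invr_gt0 ltr0n.
have vq k x : v x <= q k x.
  by have [_] := proj_min Om0 Omk (eta x) (Q0 x); apply.
have Oproj x : Om (Defs.proj Om (Q x) (eta x)).
  by have [] := proj_min Om0 Omk (eta x) (Q0 x).
have exk m x : exists k, good m k x.
  have [k hk] := bform_dense (Q x) (eta x) wd (Oproj x) (m0 m).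
  exists k; apply/asboolP => k'; apply: le_trans (ltW hk) _.
  by rewrite lerD2r; exact: vq.
have mq k : measurable_fun [set: T] (q k).
  by apply: measurable_bform => //; apply: mx_measurableB => //; exact: mx_measurable_cst.
have mgood m k : measurable [set x | good m k x].
  rewrite (_ : mkset _ = \bigcap_k' [set x | q k x <= q k' x + m.+1%:R^-1]); last first.
    apply/seteqP; split => x /=; first by move=> /asboolP h k' _; exact: h.
    by move=> h; apply/asboolP => k'; exact: h.
  apply: bigcapT_measurable => k'.
  have := @measurable_fun_ler _ _ _ setT _ _ (mq k)
    (measurable_funD (mq k') (measurable_cst (m.+1%:R^-1 : R))).
  by move=> /(_ measurableT [set true]); rewrite setTI; apply.
(* Choosing the least good index gives a countably valued selection with measurable level sets; the
   selected points converge to the projection by [proj_sharp]. *)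
pose N m x := ex_minn (exk m x).
have mN m k : measurable [set x | N m x = k].
  rewrite (_ : mkset _ = [set x | good m k x] `&`
     \bigcap_j (if (j < k)%N then ~` [set x | good m j x] else [set: T])); last first.
    apply/seteqP; split => x /=.
      rewrite /N; case: ex_minnP => l gl lmin <-; split => // j _.
      case: ifPn => // jl /= gj; by have := lmin j gj; rewrite leqNgt jl.
    move=> [gk h]; rewrite /N; case: ex_minnP => l gl lmin.
    apply/eqP; rewrite eqn_leq lmin //= leqNgt; apply/negP => lk.
    by have := h l Logic.I; rewrite lk; apply.
  apply: measurableI => //; apply: bigcapT_measurable => j.
  by case: ifPn => // _; exact: measurableC.
move=> i j; rewrite ord1.
apply: (@measurable_fun_cvg _ _ _ _ (fun m x => w (N m x) i 0)).
  by move=> m; exact: (measurable_nat_fibres (mN m) (fun k => w k i 0)).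
move=> x _; apply/cvgrPdist_lt => e e0.
have hN m : q (N m x) x <= v x + m.+1%:R^-1.
  rewrite /N; case: ex_minnP => l /asboolP hl _.
  apply/ler_addgt0Pr => e' e'0.
  have [k hk] := bform_dense (Q x) (eta x) wd (Oproj x) e'0.
  apply: le_trans (hl k) _; rewrite addrAC lerD2r; exact: ltW hk.
have hs m := proj_sharp (Ow (N m x)) (hN m) i.
have : \tr (invmx (Q x)) * m.+1%:R^-1 @[m --> \oo] --> (0 : R).
  rewrite -[X in _ --> X](mulr0 (\tr (invmx (Q x)))).
  by apply: cvgM; [exact: cvg_cst|exact: cvg_harmonic].
move=> /cvgr_lt/(_ (e ^+ 2)); rewrite exprn_gt0 // => /(_ isT).
apply: filterS => m hm; rewrite distrC.
rewrite -(ltr_pXn2r (isT : (0 < 2)%N)) ?nnegrE //; last exact: ltW.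
by rewrite real_normK ?num_real //; exact: le_lt_trans (hs m) hm.
Qed.

End proj_measurability.

(** * Functions with zero conditional mean *)

Section cdf.
Context (R : realType) (f F : R -> R).
Hypothesis fm : measurable_fun [set: R] f.
Hypothesis f0 : forall z, 0 <= f z.
Hypothesis f1 : (\int[@lebesgue_measure R]_z (f z)%:E = 1)%E.
Hypothesis FE : forall c, ((F c)%:E =
  \int[@lebesgue_measure R]_(z in `]-oo, c]) (f z)%:E)%E.

Lemma density_cdf_increment a c : a <= c -> ((F c - F a)%:E =
  \int[@lebesgue_measure R]_(z in `]a, c]) (f z)%:E)%E.
Proof.
move=> ac; have acE : `]-oo, c]%classic = `]-oo, a]%classic `|` `]a, c]%classic.
  by rewrite -itv_bndbnd_setU // bnd_simp.
have : (F c)%:E = ((F a)%:E + \int[@lebesgue_measure R]_(z in `]a, c]) (f z)%:E)%E.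
  rewrite !FE acE ge0_integral_setU //=.
  - by apply/measurable_EFinP; exact: measurable_funS fm.
  - by move=> z _; rewrite lee_fin.
  - apply/disj_setPS => z /=; rewrite !in_itv /= => -[za /andP[az _]].
    by move: za; rewrite leNgt az.
by move=> h; rewrite EFinB h addeAC subee // add0e.
Qed.

Lemma density_cdf_homo : {homo F : x y / x <= y}.
Proof.
move=> x y xy; rewrite -subr_ge0 -lee_fin density_cdf_increment //.
by apply: integral_ge0 => z _; rewrite lee_fin.
Qed.

Lemma density_cdf_01 c : 0 <= F c <= 1.
Proof.
apply/andP; split; rewrite -lee_fin FE.
  by apply: integral_ge0 => z _; rewrite lee_fin.
rewrite -f1; apply: ge0_subset_integral => //=.
  by apply/measurable_EFinP.
by move=> z _; rewrite lee_fin.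
Qed.

Lemma density_cdf_increment_ge (m lo hi a c : R) :
  (forall z, lo <= z <= hi -> m <= f z) -> lo <= a -> a <= c -> c <= hi ->
  m * (c - a) <= F c - F a.
Proof.
move=> hm la ac ch; rewrite -lee_fin density_cdf_increment //.
have [m0|/ltW m0] := leP m 0.
  apply: (@le_trans _ _ 0%E).
    by rewrite lee_fin mulr_le0_ge0 // subr_ge0.
  by apply: integral_ge0 => z _; rewrite lee_fin.
apply: (@le_trans _ _ (\int[@lebesgue_measure R]_(z in `]a, c]) m%:E)%E).
  rewrite integral_cst //= lebesgue_measure_itv /= lte_fin.
  case: ifPn => [_|]; first by rewrite -EFinB -EFinM.
  rewrite -leNgt => ca; have -> : c = a by apply/le_anti; rewrite ca ac.
  by rewrite subrr mulr0 mule0.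
apply: ge0_le_integral => //=.
- by apply/measurable_EFinP; exact: measurable_funS fm.
- move=> z; rewrite in_itv /= => /andP[az zc]; rewrite lee_fin; apply: hm.
  by rewrite (le_trans la (ltW az)) (le_trans zc ch).
Qed.

(** Dominated convergence with the density as dominating function; along a sequence above [c] the
    indicators of the half-lines converge everywhere, at [c] too. *)
Lemma density_cdf_right_continuous c : F t @[t --> c^'+] --> F c.
Proof.
apply/cvg_at_rightP => u [cu uc].
suff /fine_cvgP[_] : (F (u n))%:E @[n --> \oo] --> (F c)%:E by [].
pose g (D : set R) := (fun z => (f z)%:E) \_ D.
have gE t : (F t)%:E = (\int[@lebesgue_measure R]_z g `]-oo, t]%classic z)%E.
  by rewrite FE integral_mkcond.
have gm t : measurable_fun [set: R] (g `]-oo, t]%classic).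
  apply/(measurable_restrictT _ _).1 => //.
  by apply/measurable_EFinP; exact: measurable_funS fm.
have fint : (@lebesgue_measure R).-integrable [set: R] (EFin \o f).
  apply/integrableP; split; first exact/measurable_EFinP.
  under eq_integral do rewrite /= ger0_norm //.
  by rewrite f1 ltry.
have [] := @dominated_convergence _ _ R (@lebesgue_measure R) setT measurableT
  (fun n => g `]-oo, u n]%classic) (g `]-oo, c]%classic) (EFin \o f).
- by move=> n; exact: gm.
- exact: gm.
- apply: aeW => z _; rewrite /g patchE.
  case: ifPn => [|/negP]; rewrite inE /= in_itv /= => zc.
    apply: cvg_near_cst; apply: nearW => n; rewrite patchE ifT // inE /= in_itv /=.
    exact: le_trans zc (ltW (cu n)).
  have {}zc : c < z by rewrite ltNge; apply/negP.
  apply: cvg_near_cst; have /cvgr_lt/(_ z zc) := uc; apply: filterS => n unz.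
  by rewrite patchE ifF //; apply/negbTE/negP; rewrite inE /= in_itv /= leNgt unz.
- exact: fint.
- apply: aeW => z n _; rewrite /g patchE /=; case: ifPn => _.
    by rewrite /= lee_fin ger0_norm.
  by rewrite abse0 lee_fin.
move=> _ _; rewrite -gE; under eq_fun do rewrite -gE.
by [].
Qed.

End cdf.

Section null_mean.
Context d (T : measurableType d) (R : realType) (P : probability T R).
Context (gen : set (set T)).
Hypothesis hG : <<s gen>> `<=` @measurable d T.

(** Zero conditional expectation given the generated sigma-algebra, in integral form. Boundedness is
    part of the notion so that sums and products remain integrable. *)
Definition null_mean (h : T -> R) : Prop :=
  [/\ measurable_fun [set: T] h, exists K, forall x, `|h x| <= K &
      forall A, <<s gen>> A -> (\int[P]_(x in A) (h x)%:E = 0)%E].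

Lemma bounded_integrable (h : T -> R) (K : R) (A : set T) : measurable A ->
  measurable_fun [set: T] h -> (forall x, `|h x| <= K) ->
  P.-integrable A (EFin \o h).
Proof.
move=> mA hm hK; apply: measurable_bounded_integrable => //.
- by rewrite (le_lt_trans (probability_le1 _ mA)) // ltry.
- exact: measurable_funS hm.
- exists K; split; first exact: num_real.
  by move=> K' KK' x _ /=; apply: le_trans (hK x) (ltW KK').
Qed.

Lemma null_meanD h1 h2 : null_mean h1 -> null_mean h2 ->
  null_mean (fun x => h1 x + h2 x).
Proof.
move=> [m1 [K1 k1] z1] [m2 [K2 k2] z2]; split.
- exact: measurable_funD.
- by exists (K1 + K2) => x; apply: le_trans (ler_normD _ _) (lerD _ _).
- move=> A GA; have mA := hG GA.
  under eq_integral do rewrite EFinD.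
  rewrite integralD_EFin // ?z1 ?z2 ?adde0 //.
    exact: bounded_integrable m1 k1.
  exact: bounded_integrable m2 k2.
Qed.

Lemma null_meanZ a h : null_mean h -> null_mean (fun x => a * h x).
Proof.
move=> [hm [K hK] hz]; split.
- by apply: measurable_funM => //; exact: measurable_cst.
- by exists (`|a| * K) => x; rewrite normrM ler_wpM2l.
- move=> A GA; have mA := hG GA.
  under eq_integral do rewrite EFinM.
  by rewrite integralZl ?hz ?mule0 //; exact: bounded_integrable hm hK.
Qed.

(** A known bounded factor may be pulled out of a conditional expectation: for a constant factor
    this is [null_meanZ], and the substitution result applied to [c * h x] replaces the constant by
    [u x]. *)
Lemma null_mean_mul (u h : T -> R) (K : R) : measurable_wrt (<<s gen>>) u ->
  (forall x, `|u x| <= K) -> null_mean h -> null_mean (fun x => u x * h x).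
Proof.
move=> um uK [hm [B hB] hz].
have hHm c : measurable_fun [set: T] (fun x => c * h x).
  by apply: measurable_funM => //; exact: measurable_cst.
have hH0 c A : <<s gen>> A -> (\int[P]_(x in A) (c * h x)%:E = 0)%E.
  by move=> GA; have [_ _] := null_meanZ c (And3 hm (ex_intro _ B hB) hz); apply.
have hK x c : u x <= c <= u x + 1 -> `|c * h x| <= (K + 1) * B.
  move=> /andP[c1 c2]; rewrite normrM ler_pM // ler_norml.
  have := uK x; rewrite ler_norml => /andP[k1 k2].
  by apply/andP; split; lra.
have hr x : c * h x @[c --> (u x)^'+] --> u x * h x.
  by apply: cvgM; [exact/cvg_at_right_filter/cvg_id|exact: cvg_cst].
split.
- exact: (measurable_substitution hG um (H := fun x c => c * h x) hHm hr).
- by exists (K * B) => x; rewrite normrM ler_pM.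
- move=> A GA; exact: (integral_substitution hG um (H := fun x c => c * h x) hHm hH0 hK hr GA).
Qed.

(** The conditional distribution function is a version of a conditional probability only for each
    fixed threshold. The indicator and [F x] are both right continuous in the threshold, which
    permits a random one. *)
Lemma null_mean_threshold (w X : T -> R) (F f : T -> R -> R) :
  measurable_fun [set: T] w -> measurable_wrt (<<s gen>>) X ->
  is_cond_distribution P (<<s gen>>) w F f ->
  null_mean (fun x => (w x <= X x)%R%:R - F x (X x)).
Proof.
move=> wm Xm [hf hF].
pose H x c : R := (w x <= c)%R%:R - F x c.
have F01 x c : 0 <= F x c <= 1.
  by have [fm f0 f1 FE] := hf x; exact: (density_cdf_01 fm f0 f1 FE).
have Fm c : measurable_fun [set: T] (fun x => F x c).
  have [FG _] := hF c; move=> _ Y mY; apply: hG; apply: FG; exists Y => //.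
have indE c : (fun x => (w x <= c)%R%:R) = \1_(w @^-1` `]-oo, c]) :> (T -> R).
  apply/funext => x; rewrite indicE; congr (_ %:R); congr nat_of_bool.
  by apply/idP/idP; rewrite inE /= in_itv.
have mw c : measurable (w @^-1` `]-oo, c]).
  by rewrite -[X in measurable X]setTI; exact: wm.
have im c : measurable_fun [set: T] (fun x => (w x <= c)%R%:R : R).
  by rewrite indE; exact: measurable_indic.
have i01 (b : bool) : `|b%:R : R| <= 1 by case: b; rewrite ?normr1 ?normr0.
have Fn x c : `|F x c| <= 1 by have /andP[h1 h2] := F01 x c; rewrite ger0_norm.
have hHm c : measurable_fun [set: T] (H ^~ c).
  by apply: measurable_funB; [exact: im|exact: Fm].
have hHb x c : `|H x c| <= 1 + 1.
  by apply: le_trans (ler_normB _ _) _; exact: lerD.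
have hH0 c A : <<s gen>> A -> (\int[P]_(x in A) (H x c)%:E = 0)%E.
  move=> GA; have mA := hG GA; under eq_integral do rewrite EFinB.
  have [_ hFA] := hF c.
  rewrite integralB_EFin //; last 2 first.
    by apply: (@bounded_integrable _ 1) => //; exact: im.
    by apply: (@bounded_integrable _ 1) => //; exact: Fm.
  rewrite hFA // (_ : (\int[P]_(x in A) ((w x <= c)%R%:R)%:E)%E = P (w @^-1` `]-oo, c] `&` A)).
    by rewrite subee // fin_num_measure //; exact: measurableI.
  rewrite -(integral_indic P mA (mw c)); apply: eq_integral => x _.
  by have := congr1 (fun g => (g x)%:E) (indE c).
have hr x : H x c @[c --> (X x)^'+] --> H x (X x).
  have [fm f0 f1 FE] := hf x.
  apply: cvgB; last exact: (density_cdf_right_continuous fm f0 f1 FE).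
  apply: cvg_near_cst; have [wX|wX] := leP (w x) (X x).
    near=> c; congr (_ %:R); congr nat_of_bool.
    by rewrite (le_trans wX) //; near: c; exact: nbhs_right_ge.
  near=> c; congr (_ %:R); congr nat_of_bool; apply/negbTE.
  by rewrite -ltNge; near: c; exact: nbhs_right_lt.
split.
- exact: (measurable_substitution hG Xm (H := H) hHm hr).
- by exists (1 + 1) => x; exact: hHb.
- move=> A GA.
  exact: (integral_substitution hG Xm (H := H) hHm hH0 (fun x c _ => hHb x c) hr GA).
Unshelve. all: by end_near.
Qed.

Lemma null_mean_cond_prob (E D : set T) (c : R) : measurable E -> measurable D ->
  cond_prob_on P (<<s gen>>) E D c ->
  null_mean (fun x => \1_(E `&` D) x - c * \1_D x).
Proof.
move=> mE mD hED.
have i01 (S : set T) x : `|\1_S x : R| <= 1.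
  by rewrite indicE; case: (_ \in _); rewrite ?normr1 ?normr0.
have mED := measurableI _ _ mE mD.
have m1 : measurable_fun [set: T] (\1_(E `&` D) : T -> R) by exact: measurable_indic.
have m2 : measurable_fun [set: T] (fun x => c * \1_D x : R).
  by apply: measurable_funM; [exact: measurable_cst|exact: measurable_indic].
split.
- exact: measurable_funB.
- exists (1 + `|c|) => x; apply: le_trans (ler_normB _ _) (lerD _ _) => //.
  by rewrite normrM ler_piMr.
- move=> A GA; have mA := hG GA; under eq_integral do rewrite EFinB.
  rewrite integralB_EFin //; last 2 first.
    exact: (@bounded_integrable _ 1).
    by apply: (@bounded_integrable _ `|c|) => // x; rewrite normrM ler_piMr.
  rewrite integral_indic // [X in (X - _)%E](hED A GA).
  under eq_integral do rewrite EFinM.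
  rewrite integralZl //; last first.
    by apply: (@bounded_integrable _ 1) => //; exact: measurable_indic.
  rewrite integral_indic // subee // fin_numM // fin_num_measure //.
  exact: measurableI.
Qed.

Lemma null_mean_bit (y w X : T -> R) (F f : T -> R -> R) (s : T -> bool)
    (C p q : R) :
  measurable_fun [set: T] w -> measurable_fun [set: T] y ->
  measurable_fun [set: T] s -> measurable_wrt (<<s gen>>) X ->
  (forall x, (y x <= C) = (w x <= X x)) ->
  cond_prob_on P (<<s gen>>) [set x | s x = false] [set x | y x <= C] p ->
  cond_prob_on P (<<s gen>>) [set x | s x = true] (~` [set x | y x <= C]) q ->
  is_cond_distribution P (<<s gen>>) w F f ->
  null_mean (fun x => (1 - (p + q)) * F x (X x) + q - (s x)%:R).
Proof.
move=> wm ym sm Xm yw hp hq hF.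
have mS (b : bool) : measurable [set x | s x = b].
  by have := sm measurableT [set b]; rewrite setTI; apply.
have mY : measurable [set x | y x <= C].
  have := ym measurableT `]-oo, C]%classic; rewrite setTI => /(_ (measurable_itv _)).
  by congr measurable; apply/seteqP; split => x /=; rewrite in_itv.
have h1 := null_mean_cond_prob (mS false) mY hp.
have h2 := null_mean_cond_prob (mS true) (measurableC mY) hq.
have h3 := null_mean_threshold wm Xm hF.
(* The residual is the error of flipping a one, minus the error of flipping a zero, minus 1 - (p +
   q) times the threshold error; this is checked on the four values of the bit and of its source. *)
have := null_meanD (null_meanD h1 (null_meanZ (- 1) h2))
  (null_meanZ (- (1 - (p + q))) h3).
congr null_mean; apply/funext => x.
rewrite !indicE !in_setI !in_setC -yw.
have -> : (x \in [set x | y x <= C]) = (y x <= C).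
  by apply/idP/idP; rewrite inE.
have sE (b : bool) : (x \in [set x | s x = b]) = (s x == b).
  by apply/idP/idP; rewrite inE => /eqP.
rewrite !sE; case: (s x); case: (y x <= C) => /=; ring.
Qed.

End null_mean.

(** * A bound for bounded martingale differences *)

Section martingale.
Context d (T : measurableType d) (R : realType) (P : probability T R).
Context (gen : nat -> set (set T)) (v h : nat -> T -> R).
Hypothesis gen_meas : forall k, <<s gen k>> `<=` @measurable d T.
Hypothesis gen_homo : forall k, <<s gen k>> `<=` <<s gen k.+1>>.
Hypothesis v_adapted : forall k, measurable_wrt (<<s gen k>>) (v k).
Hypothesis v_le : forall k x, `|v k x| <= 2^-1.
Hypothesis h_adapted : forall k, measurable_wrt (<<s gen k.+1>>) (h k).
Hypothesis h_le : forall k x, `|h k x| <= 1.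
Hypothesis h_null : forall k, null_mean P (gen k) (h k).

(* The product martingale of factors [1 + v h], frozen as soon as it
   reaches [a]. *)
Fixpoint stopped (a : R) (t : nat) (x : T) : R :=
  if t is t'.+1 then
    if stopped a t' x < a then stopped a t' x * (1 + v t' x * h t' x)
    else stopped a t' x
  else 1.

Let factor_bounds k x : 2^-1 <= 1 + v k x * h k x <= 2.
Proof.
have : `|v k x * h k x| <= 2^-1.
  by rewrite normrM -[leRHS]mulr1 ler_pM.
rewrite ler_norml => /andP[? ?]; apply/andP; split; lra.
Qed.

(** Freezing makes the bound independent of [t]: the factor that crosses the level [a] overshoots it
    at most twofold. *)
Let stopped_bounds a t x : 1 <= a -> 0 <= stopped a t x <= 2 * a.
Proof.
move=> a1; elim: t => [|t /andP[s0 sa]] /=; first by apply/andP; split; lra.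
case: ifPn => [h1|_]; last by apply/andP.
have /andP[f1 f2] := factor_bounds t x.
rewrite mulr_ge0 //=; last lra.
by rewrite mulrC ler_pM // ?ltW //; lra.
Qed.

Let stopped_adapted a t : measurable_wrt (<<s gen t>>) (stopped a t).
Proof.
suff h1 : measurable_fun [set: g_sigma_algebraType (gen t)] (stopped a t).
  by move=> _ [Y mY <-]; exact: h1.
elim: t => [|t IH]; first exact: measurable_cst.
have lift (f : T -> R) : measurable_wrt (<<s gen t>>) f ->
    measurable_fun [set: g_sigma_algebraType (gen t.+1)] f.
  by move=> fm _ Y mY; apply: gen_homo; apply: fm; exists Y.
have sm : measurable_fun [set: g_sigma_algebraType (gen t.+1)] (stopped a t).
  by apply: lift => _ [Y mY <-]; exact: IH.
rewrite /=; apply: measurable_fun_ifT => //.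
  by apply: measurable_fun_ltr => //; exact: measurable_cst.
apply: measurable_funM => //; apply: measurable_funD; first exact: measurable_cst.
apply: measurable_funM; first by apply: lift; exact: v_adapted.
by move=> _ Y mY; apply: h_adapted; exists Y.
Qed.

Let stopped_measurable a t : measurable_fun [set: T] (stopped a t).
Proof. by move=> _ Y mY; apply: (@gen_meas t); apply: stopped_adapted; exists Y. Qed.

Let stopped_int a t : 1 <= a -> (\int[P]_x (stopped a t x)%:E = 1)%E.
Proof.
move=> a1; have sB k x : `|stopped a k x| <= 2 * a.
  by have /andP[s0 s1] := @stopped_bounds a k x a1; rewrite ger0_norm.
elim: t => [|t IH].
  by rewrite /= integral_cst // mul1e; exact: probability_setT.
(* [u] gathers what is known before the new increment, including the indicator of not being frozen,
   so a step adds [u * h] and keeps the mean. *)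
pose u x := stopped a t x * (stopped a t x < a)%R%:R * v t x.
have uG : measurable_wrt (<<s gen t>>) u.
  suff h1 : measurable_fun [set: g_sigma_algebraType (gen t)] u.
    by move=> _ [Y mY <-]; exact: h1.
  have sm : measurable_fun [set: g_sigma_algebraType (gen t)] (stopped a t).
    by move=> _ Y mY; apply: stopped_adapted; exists Y.
  apply: measurable_funM; last by move=> _ Y mY; apply: v_adapted; exists Y.
  apply: measurable_funM => //.
  rewrite (_ : (fun x => _) = (fun x => if stopped a t x < a then 1 else 0)); last first.
    by apply/funext => x; case: ifP.
  apply: measurable_fun_ifT; [|exact: measurable_cst..].
  by apply: measurable_fun_ltr => //; exact: measurable_cst.
have uB x : `|u x| <= 2 * a * 1 * 2^-1.
  rewrite /u !normrM; apply: ler_pM => //; apply: ler_pM => //.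
  by case: (_ < _); rewrite ?normr1 ?normr0.
have [um [K uK] unull] := null_mean_mul (@gen_meas t) uG uB (h_null t).
have stepE x : stopped a t.+1 x = stopped a t x + u x * h t x.
  by rewrite /= /u; case: ifP => _ /=; ring.
under eq_integral do rewrite stepE EFinD.
rewrite integralD_EFin //.
- rewrite IH unull ?adde0 //.
  exact: (@measurableT _ (g_sigma_algebraType (gen t))).
- exact: (bounded_integrable _ _ (stopped_measurable a t) (sB t)).
- exact: (bounded_integrable _ _ um uK).
Qed.

Let stopped_frozen a t x : a <= stopped a t x -> a <= stopped a t.+1 x.
Proof. by move=> h1; rewrite /= ltNge h1. Qed.

Let bad_meas a t : measurable [set x | a <= stopped a t x].
Proof.
have := stopped_measurable a t measurableT (measurable_itv `[a, +oo[).
rewrite setTI.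
by congr measurable; apply/seteqP; split => x /=; rewrite in_itv /= andbT.
Qed.

Let tail a t : 1 <= a -> (P [set x | (a <= stopped a t x)%R] <= (a^-1)%:E)%E.
Proof.
move=> a1; have a0 : 0 < a by lra.
have mE := bad_meas a t.
rewrite -[leRHS]mul1e -(stopped_int t a1) lee_pdivlMr //.
rewrite -[X in (P X * _)%E]setIT muleC -integral_indic // -ge0_integralZl //.
- apply: ge0_le_integral; first exact: measurableT.
  + by move=> x _; rewrite mule_ge0 // lee_fin // ltW.
  + apply: emeasurable_funM; first exact: measurable_cst.
    by apply/measurable_EFinP; exact: measurable_indic.
  + by apply/measurable_EFinP; exact: stopped_measurable.
  move=> x _; rewrite -EFinM lee_fin indicE.
  case: (boolP (x \in _)) => [|_]; first by rewrite inE /= mulr1.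
  by rewrite mulr0; have /andP[] := @stopped_bounds a t x a1.
- by apply/measurable_EFinP; exact: measurable_indic.
- by rewrite lee_fin ltW.
Qed.

Let bad a := \bigcup_t [set x | a <= stopped a t x].

(** The maximal inequality: a frozen path stays above the level, so the events increase in [t] and
    Markov's bound at each single time passes to their union. *)
Let bad_le a : 1 <= a -> (P (bad a) <= (a^-1)%:E)%E.
Proof.
move=> a1; have homo : {homo (fun t => [set x | a <= stopped a t x]) :
    n m / (n <= m)%N >-> (n <= m)%O}.
  move=> m n mn; apply/subsetPset => x /= hx; rewrite -(subnK mn).
  by elim: (n - m)%N => // k IH; rewrite addSn; exact: stopped_frozen.
have hc := nondecreasing_cvg_mu (mu := P) (bad_meas a)
  (bigcup_measurable (fun t _ => bad_meas a t)) homo.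
have hcl := cvg_lim (@ereal_hausdorff R) hc.
rewrite -hcl; apply: lime_le; first by apply/cvg_ex; eexists; exact: hc.
by apply: nearW => t; exact: tail.
Qed.

Let stopped_prod a t x : (forall j, stopped a j x < a) ->
  stopped a t x = \prod_(k < t) (1 + v k x * h k x).
Proof.
move=> lt_a; elim: t => [|t IH]; first by rewrite big_ord0.
by rewrite big_ord_recr /= lt_a IH.
Qed.

(** From ln(1 + z) >= z / (1 + z); the remaining difference has the sign of z^2 (1 + 2z), which is
    why |z| <= 1/2 and the constant 2 go together. *)
Let ln1D_ge (z : R) : `|z| <= 2^-1 -> z - 2 * z ^+ 2 <= ln (1 + z).
Proof.
rewrite ler_norml => /andP[z1 z2].
have z0 : 0 < 1 + z by lra.
have : ln (1 + (- (z / (1 + z)))) <= - (z / (1 + z)).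
  apply: le_ln1Dx; rewrite ltrN2 ltr_pdivrMr // mul1r; lra.
have -> : 1 + (- (z / (1 + z))) = (1 + z)^-1 by field; rewrite gt_eqF.
rewrite lnV ?posrE // lerN2; apply: le_trans.
rewrite ler_pdivlMr // -subr_ge0.
have -> : z - (z - 2 * z ^+ 2) * (1 + z) = z ^+ 2 * (1 + 2 * z) by ring.
by rewrite mulr_ge0 ?sqr_ge0 //; lra.
Qed.

Lemma martingale_bound : {ae P, forall x, exists K, forall t,
  \sum_(k < t) v k x * h k x <= 2 * (\sum_(k < t) v k x ^+ 2) + K}.
Proof.
pose N := \bigcap_n bad n.+1%:R.
have mbad n : measurable (bad n.+1%:R).
  by apply: bigcup_measurable => t _; exact: bad_meas.
have mN : measurable N by exact: bigcapT_measurable.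
exists N; split => //.
  apply/eqP; rewrite eq_le measure_ge0 andbT; apply/lee_addgt0Pr => e e0.
  rewrite add0e; have /archi_boundP := ltW (divr_gt0 (ltr01 : 0 < (1 : R)) e0).
  set n := Num.bound _ => hn.
  apply: (@le_trans _ _ (P (bad n.+1%:R))).
    by apply: le_measure; rewrite ?inE // => x; apply.
  apply: le_trans (bad_le _) _; first by rewrite ler1n.
  rewrite lee_fin invf_ple ?posrE ?ltr0n //; apply: ltW.
  by rewrite -[e^-1]mul1r; apply: lt_trans hn _; rewrite ltr_nat.
move=> x /= hx; apply: contrapT => nNx; apply: hx.
have [n hn] : exists n, ~ bad n.+1%:R x.
  by apply: contrapT => /forallNP h1; apply: nNx => n _; apply: contrapT; exact: h1.
have lt_a j : stopped n.+1%:R j x < n.+1%:R.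
  by rewrite ltNge; apply/negP => h1; apply: hn; exists j.
exists (ln n.+1%:R) => t.
have prod0 s : 0 < \prod_(k < s) (1 + v k x * h k x).
  apply: prodr_gt0 => k _; have /andP[] := factor_bounds k x; lra.
have lnprod s : ln (\prod_(k < s) (1 + v k x * h k x)) = \sum_(k < s) ln (1 + v k x * h k x).
  elim: s => [|s IH]; first by rewrite !big_ord0 ln1.
  have fp : 0 < 1 + v s x * h s x by have /andP[] := factor_bounds s x; lra.
  by rewrite !big_ord_recr /= lnM ?posrE ?prod0 // IH.
have : ln (\prod_(k < t) (1 + v k x * h k x)) <= ln n.+1%:R.
  by rewrite ler_ln ?posrE ?prod0 ?ltr0n // -(stopped_prod t lt_a) ltW.
rewrite lnprod => hln.
rewrite -lerBlDl; apply: le_trans hln.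
rewrite mulr_sumr -sumrB; apply: ler_sum => k _.
have vh : `|v k x * h k x| <= 2^-1 by rewrite normrM -[leRHS]mulr1 ler_pM.
apply: le_trans (ln1D_ge vh); rewrite lerD2l lerN2 ler_pM2l // exprMn.
rewrite ler_piMr ?sqr_ge0 //; have := h_le k x.
by rewrite -real_normK ?num_real // => h1; rewrite expr_le1.
Qed.

End martingale.

(** * Asymptotics and block matrices *)

Section bigO_log.
Context (R : realType).

(** A bounded [r] converges and bounds [X]; if its limit differs from 1 then |ln r| stays away from
    0 and absorbs the constant. The limit may lie below 1, so absolute values are kept. *)
Lemma bigO_log_intro (X r : nat -> R) (K1 K2 T0 c : R) :
  (forall t, 0 <= X t) -> 0 <= K2 -> 0 <= T0 -> 0 < c ->
  {homo r : s t / (s <= t)%N >-> s <= t} -> 0 < r 0%N ->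
  (forall t, X t <= K1 + K2 * ln (T0 + c * r t)) -> bigO_log X r.
Proof.
move=> X0 K20 T00 c0 rh r00 hX.
have r0 t : 0 < r t by apply: lt_le_trans r00 (rh _ _ (leq0n t)).
have arg0 z : 0 < z -> 0 < T0 + c * z by move=> z0; rewrite ltr_wpDl // mulr_gt0.
have bounded l : (forall t, r t <= l) -> exists2 K, 0 < K & forall t, X t <= K.
  move=> rl; have l0 : 0 < l by exact: lt_le_trans (rl 0%N).
  exists (Num.max 1 (K1 + K2 * ln (T0 + c * l))); first by rewrite lt_max ltr01.
  move=> t; rewrite le_max; apply/orP; right; apply: le_trans (hX t) _.
  by rewrite lerD2l ler_wpM2l // ler_ln ?posrE ?arg0 // lerD2l ler_pM2l.
split.
- move=> nr1; have [[l hl]|nub] := pselect (exists l, forall t, r t <= l).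
    have [K K0 XK] := bounded l hl.
    have ub : has_ubound (range r) by exists l => _ [t _ <-].
    have rcvg := nondecreasing_cvgn rh ub; set m := sup _ in rcvg.
    have m0 : 0 < m by apply: lt_le_trans (r0 0%N) (ub_le_sup ub _); exists 0%N.
    have m1 : m != 1 by apply/eqP => m1; apply: nr1; rewrite -m1.
    have lnm : 0 < `|ln m| by rewrite normr_gt0 ln_eq0.
    have lncvg : `|ln (r t)| @[t --> \oo] --> `|ln m|.
      by apply: cvg_norm; apply: (cvg_comp _ _ rcvg); exact: continuous_ln m0.
    apply/eqO_exP; exists (2 * K / `|ln m|); first by rewrite divr_gt0 ?mulr_gt0.
    have hm : `|ln m| / 2 < `|ln m| by rewrite ltr_pdivrMr // ltr_pMr // ltr1n.
    have /cvgr_gt/(_ _ hm) := lncvg; apply: filterS => t ht.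
    rewrite ger0_norm //; apply: le_trans (XK t) _.
    apply: (@le_trans _ _ (2 * K / `|ln m| * (`|ln m| / 2))).
      by rewrite le_eqVlt; apply/orP; left; apply/eqP; field; rewrite gt_eqF.
    by rewrite ler_pM2l ?ltW // divr_gt0 ?mulr_gt0.
  (* As [r] never falls below its positive initial value, T0 + c r <= c' r, so the shift costs only
     the constant ln c'. *)
  pose c' := T0 / r 0%N + c.
  have c'0 : 0 < c' by rewrite /c' ltr_wpDl // divr_ge0 // ltW.
  pose k := `|K1 + K2 * ln c'| + K2 + 1.
  apply/eqO_exP; exists k; first by rewrite /k ltr_wpDl // addr_ge0.
  have [t0 ht0] : exists t0, expR 1 < r t0.
    apply: contrapT => /forallNP h; apply: nub; exists (expR 1) => t.
    by rewrite leNgt; apply/negP; exact: h.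
  exists t0 => // t /= tt0; rewrite ger0_norm //.
  have ln1 : 1 <= ln (r t).
    rewrite -[leLHS]expRK ler_ln ?posrE ?expR_gt0 //.
    by apply: le_trans (ltW ht0) (rh _ _ tt0).
  rewrite [X in _ * X]ger0_norm; last exact: le_trans ln1.
  apply: le_trans (hX t) _.
  have : ln (T0 + c * r t) <= ln c' + ln (r t).
    rewrite -lnM ?posrE // ler_ln ?posrE ?arg0 ?mulr_gt0 // /c' mulrDl lerD2r.
    by rewrite mulrAC ler_pdivlMr // ler_wpM2l //; exact: rh.
  move=> /(ler_wpM2l K20) hln.
  have := ler_norm (K1 + K2 * ln c').
  have := ler_wpM2l (normr_ge0 (K1 + K2 * ln c')) ln1.
  rewrite /k; lra.
- move=> r1; have rle t : r t <= 1.
    rewrite -(cvg_lim (@Rhausdorff R) r1); apply: nondecreasing_cvgn_le => //.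
    by apply/cvg_ex; exists 1.
  have [K K0 XK] := bounded 1 rle.
  apply/eqO_exP; exists K => //; apply: nearW => t.
  by rewrite normr1 mulr1 ger0_norm.
Qed.

End bigO_log.

Section stack.
Context (R : realType) (n p : nat).

Lemma stack_diag_sum q (B : 'I_n -> 'M[R]_(p, q)) m (C : 'I_n -> 'M[R]_(m, p)) j :
  \sum_i C i *m (B i *+ (i == j)) = C j *m B j.
Proof.
rewrite (bigD1 j) //= eqxx mulr1n big1 ?addr0 // => i ij.
by rewrite (negbTE ij) mulr0n mulmx0.
Qed.

Lemma invmx_stack_diag (P : 'I_n -> 'M[R]_p) : (forall i, P i \in unitmx) ->
  invmx (stack_diag P) = stack_diag (fun i => invmx (P i)).
Proof.
move=> uP.
have key : stack_diag P *m stack_diag (fun i => invmx (P i)) = 1%:M.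
  rewrite /stack_diag mul_mxblock -(@mxdiagZ R n (fun=> p)); apply: eq_mxblock => i j.
  rewrite (stack_diag_sum _ (fun k => P i *+ (i == k))).
  case: eqVneq => [<-|_]; last by rewrite mulr0n mul0mx.
  by rewrite mulr1n mulmxV // conform_mx_id.
have [uS _] := mulmx1_unit key.
by rewrite -[RHS]mul1mx -(mulVmx uS) -mulmxA key mulmx1.
Qed.

Lemma stack_quad_form (P : 'I_n -> 'M[R]_p) (x : 'I_n -> 'cV[R]_p) :
  (forall i, P i \in unitmx) ->
  ((stack_col x)^T *m invmx (stack_diag P) *m stack_col x) 0 0 =
  \sum_i bform (invmx (P i)) (x i) (x i).
Proof.
move=> uP; rewrite invmx_stack_diag // /stack_col tr_mxcol mul_mxrow_mxblock.
rewrite mul_mxrow_mxcol summxE; apply: eq_bigr => j _.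
by rewrite (stack_diag_sum _ (fun i => (x i)^T)).
Qed.

Lemma stack_regression (phi x : 'I_n -> 'cV[R]_p) :
  ((stack_col x)^T *m stack_diag phi *m (stack_diag phi)^T *m stack_col x) 0 0 =
  \sum_i dotv (phi i) (x i) ^+ 2.
Proof.
rewrite -mulmxA -[X in _ *m X]trmxK trmx_mul trmxK.
rewrite /stack_col tr_mxcol mul_mxrow_mxblock.
rewrite tr_mxrow mul_mxrow_mxcol summxE; apply: eq_bigr => j _.
rewrite (stack_diag_sum _ (fun i => (x i)^T)) trmx_mul trmxK.
by rewrite [LHS]mxE big_ord1 -!/(dotv _ _) (dotvC (x j)) expr2.
Qed.

End stack.

(** * Adaptedness of the estimates *)

Section adapted_run.
Context (R : realType) (n p : nat) (A : 'M[R]_n) (Om : set 'cV[R]_p) (C : R).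
Context (pf qf beta : 'I_n -> R) (theta0 : 'I_n -> 'cV[R]_p).
Context (P0 : 'I_n -> 'M[R]_p).
Context d (T : measurableType d) (Pr : probability T R).
Context (gen : nat -> set (set T)) (phi : nat -> 'I_n -> T -> 'cV[R]_p).
Context (w : nat -> 'I_n -> T -> R) (F f : nat -> 'I_n -> T -> R -> R).
Context (s : nat -> 'I_n -> T -> bool).
Context (thetah psi : nat -> 'I_n -> T -> 'cV[R]_p).
Context (P Pbar : nat -> 'I_n -> T -> 'M[R]_p).
Hypothesis gen_homo : forall k, <<s gen k>> `<=` <<s gen k.+1>>.
Hypothesis hA : weighted_adjacency A.
Hypotheses (hOm0 : Om !=set0) (hOmk : compact Om) (hOmc : convex_set Om).
Hypothesis hP0 : forall i, sym_posdef (P0 i).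
Hypothesis hphi : forall k i (l : 'I_p),
  measurable_wrt (<<s gen k>>) (fun x => phi k i x l 0).
Hypothesis hs : forall k i, measurable_wrt (<<s gen k.+1>>) (s k.+1 i).
Hypothesis hF : forall k i, is_cond_distribution Pr (<<s gen k>>)
  (w k.+1 i) (F k i) (f k i).
Hypothesis hrun : forall x, algorithm_run A Om C pf qf beta theta0 P0
  (fun k i => phi k i x) (fun k i => F k i x) (fun k i => s k i x)
  (fun k i => thetah k i x) (fun k i => P k i x)
  (fun k i => psi k i x) (fun k i => Pbar k i x).

Notation TG k := (g_sigma_algebraType (gen k)).

Lemma measurable_wrtP k d' (U : measurableType d') (X : T -> U) :
  measurable_wrt (<<s gen k>>) X <-> measurable_fun [set: TG k] X.
Proof.
split=> h; first by move=> _ Y mY; apply: h; exists Y.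
by move=> _ [Y mY <-]; exact: h.
Qed.

Lemma lift_measurable k (X : T -> R) :
  measurable_fun [set: TG k] X -> measurable_fun [set: TG k.+1] X.
Proof. by move=> /measurable_wrtP h; apply/measurable_wrtP => B /h; exact: gen_homo. Qed.

Lemma regressor_measurable k i : mx_measurable (phi k i : TG k -> 'cV[R]_p).
Proof. by move=> l j; rewrite ord1; apply/measurable_wrtP; exact: hphi. Qed.

Lemma measurable_cond_cdf k i (X : T -> R) : measurable_fun [set: TG k] X ->
  measurable_fun [set: TG k] (fun x => F k i x (X x)).
Proof.
move=> mX; have [hf hc] := hF k i.
(* The substitution result is applied to the space that carries the sub-sigma-algebra itself, which
   yields adaptedness and not only measurability. *)
have sub : <<s gen k>> `<=` @measurable _ (TG k) by [].
apply: (@measurable_substitution _ (TG k) R (gen k) sub X (F k i)).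
- exact/measurable_wrtP.
- by move=> c; have [h _] := hc c; apply/measurable_wrtP.
- move=> x; have [fm f0 f1 FE] := hf x.
  exact: (density_cdf_right_continuous fm f0 f1 FE).
Qed.

(** Step k + 1 uses the bit received at time k + 1, so the induction works over [TG k.+1].
    Information matrices are followed first, because their positive definiteness makes inversion
    measurable. *)
Lemma run_adapted k i : mx_measurable (P k i : TG k -> 'M[R]_p) /\
  mx_measurable (thetah k i : TG k -> 'cV[R]_p).
Proof.
elim: k i => [|k IH] i.
  split => a b.
    by under eq_fun do rewrite (run_P0 (hrun _)); exact: measurable_cst.
  by under eq_fun do rewrite (run_theta0 (hrun _)); exact: measurable_cst.
have liftmx a b (g : T -> 'M[R]_(a, b)) : mx_measurable (g : TG k -> _) ->
    mx_measurable (g : TG k.+1 -> _).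
  by move=> hg l j; apply: lift_measurable; exact: hg.
have mP j : mx_measurable (P k j : TG k.+1 -> 'M[R]_p).
  by apply: liftmx; have [] := IH j.
have mth j : mx_measurable (thetah k j : TG k.+1 -> 'cV[R]_p).
  by apply: liftmx; have [] := IH j.
have mphi j : mx_measurable (phi k j : TG k.+1 -> 'cV[R]_p).
  apply: liftmx; exact: regressor_measurable.
have pos l j x : sym_posdef (P l j x) by exact: (run_posdef hA hP0 (hrun x)).
pose E j x := invmx (P k j x) + beta j ^+ 2 *: (phi k j x *m (phi k j x)^T).
have Epos j x : sym_posdef (E j x) by exact: (info_bar_posdef hA hP0 (hrun x) k j).
have mE j : mx_measurable (E j : TG k.+1 -> 'M[R]_p).
  apply: mx_measurableD; first exact: (@mx_measurable_inv _ (TG k.+1) R p _ (pos k j) (mP j)).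
  apply: mx_measurableZ; first exact: measurable_cst.
  by apply: mx_measurableM => //; exact: mx_measurable_tr.
pose J i x := \sum_j A i j *: E j x.
have JE x : J i x = invmx (P k.+1 i x) by exact: esym (infoS hA hP0 (hrun x) k i).
have mJ : mx_measurable (J i : TG k.+1 -> 'M[R]_p).
  apply: mx_measurable_sum => j.
  by apply: mx_measurableZ; [exact: measurable_cst|exact: mE].
have Jpos x : sym_posdef (J i x) by rewrite JE; exact/posdef_inv.
have mP1 : mx_measurable (P k.+1 i : TG k.+1 -> 'M[R]_p).
  rewrite (_ : P k.+1 i = fun x => invmx (J i x)).
    exact: (@mx_measurable_inv _ (TG k.+1) R p _ Jpos mJ).
  by apply/funext => x; rewrite JE invmxK.
split=> //.
have mpsi j : mx_measurable (psi k.+1 j : TG k.+1 -> 'cV[R]_p).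
  rewrite (_ : psi k.+1 j = fun x => Defs.proj Om (E j x)
      (thetah k j x + (gain (beta j) (P k j x) (phi k j x) * beta j *
        ((1 - (pf j + qf j)) * F k j x (C - dotv (thetah k j x) (phi k j x))
         + qf j - (s k.+1 j x)%:R)) *: (P k j x *m phi k j x))); last first.
    apply/funext => x; rewrite (run_psi (hrun x)).
    by rewrite (invmx_Pbar (hrun x) (pos k j x)).
  apply: (@mx_measurable_proj R p Om hOm0 hOmk hOmc _ (TG k.+1) _ _ (Epos j) (mE j)).
  apply: mx_measurableD => //; apply: mx_measurableZ; last exact: mx_measurableM.
  apply: measurable_funM.
    apply: measurable_funM; last exact: measurable_cst.
    apply: measurable_inv_gt0.
      move=> x; rewrite -/(bform _ _ _) ltr_pwDl // mulr_ge0 ?sqr_ge0 //.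
      exact: posdef_ge0.
    apply: measurable_funD; first exact: measurable_cst.
    apply: measurable_funM; first exact: measurable_cst.
    exact: (measurable_bform (mP j) (mphi j) (mphi j)).
  apply: measurable_funB.
    apply: measurable_funD; last exact: measurable_cst.
    apply: measurable_funM; first exact: measurable_cst.
    apply: lift_measurable; apply: measurable_cond_cdf.
    apply: measurable_funB; first exact: measurable_cst.
    by apply: measurable_dotv; [have [] := IH j|exact: regressor_measurable].
  rewrite (_ : (fun x => _) = (fun x => if s k.+1 j x then 1 else 0)); last first.
    by apply/funext => x; case: (s _ _ _).
  apply: measurable_fun_ifT; [|exact: measurable_cst..].
  by apply/measurable_wrtP; exact: hs.
rewrite (_ : thetah k.+1 i = fun x => P k.+1 i x *m
    \sum_j A i j *: (E j x *m psi k.+1 j x)); last first.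
  apply/funext => x; have := info_thetahS hA hP0 (hrun x) k i.
  rewrite /info_bar /info => <-.
  by rewrite mulmxA -[X in X *m invmx _]invmxK posdef_Vmul ?mul1mx //; exact: posdef_inv.
apply: mx_measurableM => //; apply: mx_measurable_sum => j.
apply: mx_measurableZ; first exact: measurable_cst.
exact: mx_measurableM.
Qed.

Section noise_bound.
Context (th : 'cV[R]_p) (B b : R).
Hypothesis gen_meas : forall k, <<s gen k>> `<=` @measurable d T.
Hypothesis B0 : 0 <= B.
Hypothesis b0 : 0 < b.
Hypothesis hpf : forall i, 0 <= pf i < 1.
Hypothesis hqf : forall i, 0 <= qf i < 1.
Hypothesis hpq : forall i, pf i + qf i != 1.

Let X k i x : R := C - dotv th (phi k i x).
Let h k i x : R := (1 - (pf i + qf i)) * F k i x (X k i x) + qf i - (s k.+1 i x)%:R.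
(** Clamping the true prediction as well makes [clp] bounded at every sample point, also where the
    regressor bound fails; where that bound holds it agrees with [clip]. *)
Let clp k i x : R := clamp B (dotv (thetah k i x) (phi k i x)) -
  clamp B (dotv th (phi k i x)).

Hypothesis h_null : forall k i, null_mean Pr (gen k) (h k i).

Lemma clipped_noise_bound i : {ae Pr, forall x, exists K, forall t : nat,
  \sum_(k < t) 2 * (Num.sg (1 - (pf i + qf i)) * b) * h k i x * clp k i x <=
  b ^+ 2 / 2 * (\sum_(k < t) clp k i x ^+ 2) + K}.
Proof.
set sg := Num.sg _.
have sg2 : sg ^+ 2 = 1 by rewrite sqr_sg subr_eq0 eq_sym hpq.
have nsg : `|sg| = 1 by rewrite normr_sg subr_eq0 eq_sym hpq.
(* The bound b / 8 turns 4 b lam into at most b^2 / 2, and 1 / (4 (B + 1)) keeps |v| within 1/2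
   because |clp| <= 2B; the added 1 covers B = 0. *)
pose lam := Num.min (b / 8) (4 * (B + 1))^-1.
have B1 : 0 < 4 * (B + 1) by rewrite mulr_gt0 // ltr_wpDl.
have lam0 : 0 < lam by rewrite lt_min divr_gt0 // invr_gt0.
have lamb : lam <= b / 8 by rewrite ge_min lexx.
have lamB : lam * (4 * (B + 1)) <= 1.
  by rewrite -ler_pdivlMr // mul1r ge_min lexx orbT.
pose v k x := lam * sg * clp k i x.
have clp_le k x : `|clp k i x| <= 2 * B.
  have /andP[? ?] := clamp_bounds (dotv (thetah k i x) (phi k i x)) B0.
  have /andP[? ?] := clamp_bounds (dotv th (phi k i x)) B0.
  by rewrite /clp ler_norml; apply/andP; split; lra.
have v_le k x : `|v k x| <= 2^-1.
  rewrite /v !normrM nsg mulr1 gtr0_norm //.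
  apply: (@le_trans _ _ (lam * (2 * B))); first by rewrite ler_pM2l.
  lra.
have F01 k j x c : 0 <= F k j x c <= 1.
  by have [/(_ x)[fm f0 f1 FE] _] := hF k j; exact: (density_cdf_01 fm f0 f1 FE).
have h_le k x : `|h k i x| <= 1.
  exact: (@bit_residual_le1 _ _ _ _ (fun k i => F k i x) hpf hqf (fun k j => F01 k j x)).
have clamp_meas k (Y : T -> R) : measurable_fun [set: TG k] Y ->
    measurable_fun [set: TG k] (fun x => clamp B (Y x)).
  move=> mY; apply: measurable_maxr; first exact: measurable_cst.
  by apply: measurable_minr => //; exact: measurable_cst.
have mth k : measurable_fun [set: TG k] (fun x => dotv th (phi k i x)).
  by apply: measurable_dotv; [exact: mx_measurable_cst|exact: regressor_measurable].
have v_adapted k : measurable_wrt (<<s gen k>>) (v k).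
  apply/measurable_wrtP; apply: measurable_funM; first exact: measurable_cst.
  apply: measurable_funB; apply: clamp_meas => //.
  by apply: measurable_dotv; [have [] := run_adapted k i|exact: regressor_measurable].
have h_adapted k : measurable_wrt (<<s gen k.+1>>) (h k i).
  apply/measurable_wrtP; apply: measurable_funB.
    apply: measurable_funD; last exact: measurable_cst.
    apply: measurable_funM; first exact: measurable_cst.
    apply: lift_measurable; apply: measurable_cond_cdf.
    by apply: measurable_funB; [exact: measurable_cst|exact: mth].
  rewrite (_ : (fun x => _) = (fun x => if s k.+1 i x then 1 else 0)); last first.
    by apply/funext => x; case: (s _ _ _).
  apply: measurable_fun_ifT; [|exact: measurable_cst..].
  by apply/measurable_wrtP; exact: hs.
have := martingale_bound gen_meas gen_homo v_adapted v_le h_adapted h_le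
  (fun k => h_null k i).
apply: filterS => x [K hK]; exists (2 * b / lam * K) => t.
have c0 : 0 < 2 * b / lam by rewrite divr_gt0 // mulr_gt0.
have := ler_wpM2l (ltW c0) (hK t); rewrite mulrDr => hKt.
apply: (@le_trans _ _ (2 * b / lam * (\sum_(k < t) v k x * h k i x))).
  rewrite le_eqVlt; apply/orP; left; apply/eqP; rewrite mulr_sumr.
  by apply: eq_bigr => k _; rewrite /v; field; rewrite gt_eqF.
apply: le_trans hKt _; rewrite lerD2r.
have -> : \sum_(k < t) v k x ^+ 2 = lam ^+ 2 * \sum_(k < t) clp k i x ^+ 2.
  rewrite mulr_sumr; apply: eq_bigr => k _.
  by rewrite /v !exprMn sg2 mulr1.
have -> : 2 * b / lam * (2 * (lam ^+ 2 * \sum_(k < t) clp k i x ^+ 2)) =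
    (4 * b * lam) * \sum_(k < t) clp k i x ^+ 2 by field; rewrite gt_eqF.
apply: ler_wpM2r; first by apply: sumr_ge0 => k _; exact: sqr_ge0.
have := ler_wpM2l (ltW b0) lamb; lra.
Qed.

End noise_bound.
End adapted_run.

(* [natural_filtration y u w w' k] is convertible to [<<s natural_generator k>>];
   naming the generator gives access to [g_sigma_algebraType]. *)
Definition natural_generator d dU dW (T : measurableType d)
    (U : measurableType dU) (W : measurableType dW) (R : realType) (n : nat)
    (y : nat -> 'I_n -> T -> R) (u : nat -> 'I_n -> T -> U)
    (w : nat -> 'I_n -> T -> R) (w' : nat -> 'I_n -> T -> W)
    (k : nat) : set (set T) :=
  [set A | exists j i,
        ((0 < j <= k)%N /\
          (preimage_set_system [set: T] (y j i) measurable A \/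
           preimage_set_system [set: T] (w j i) measurable A \/
           preimage_set_system [set: T] (w' j i) measurable A)) \/
        ((j <= k)%N /\
          preimage_set_system [set: T] (u j i) measurable A)].

(** * The natural filtration and the conclusion *)

Section filtration.
Context d dU dW (T : measurableType d) (U : measurableType dU)
  (W : measurableType dW) (R : realType) (n : nat).
Context (y : nat -> 'I_n -> {mfun T >-> R}) (u : nat -> 'I_n -> {mfun T >-> U})
  (w : nat -> 'I_n -> {mfun T >-> R}) (w' : nat -> 'I_n -> {mfun T >-> W}).

Lemma natural_filtration_homo k :
  natural_filtration y u w w' k `<=` natural_filtration y u w w' k.+1.
Proof.
apply: smallest_sub; first exact: smallest_sigma_algebra.
move=> B [j [i h]]; apply: sub_sigma_algebra; exists j, i.
case: h => -[hj h]; [left|right]; split => //; last exact: leqW.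
by have /andP[-> /= jk] := hj; exact: leqW.
Qed.

Lemma natural_filtration_measurable k :
  natural_filtration y u w w' k `<=` @measurable d T.
Proof.
apply: smallest_sub; first exact: sigma_algebra_measurable.
have pre d' (V : measurableType d') (g : {mfun T >-> V}) B :
    preimage_set_system [set: T] g measurable B -> measurable B.
  by move=> [Y mY <-]; exact: (measurable_funPT g).
by move=> B [j [i [[_ [|[|]]]|[_]]]]; exact: pre.
Qed.

End filtration.

(** The minimum in [beta_coef] starts from an entry that varies with the node; since that entry is
    among those minimised, all nodes share one modulus [b]. *)
Lemma beta_coef_common (R : realType) (n : nat) (pf qf : 'I_n -> R) (fmin : R) :
  0 < fmin -> (forall i, pf i + qf i != 1) -> (0 < n)%N ->
  exists2 b, 0 < b & forall i,
    beta_coef pf qf fmin i = Num.sg (1 - (pf i + qf i)) * b /\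
    b <= `|1 - (pf i + qf i)| * fmin.
Proof.
move=> f0 hpq n0; pose G i := `|1 - (pf i + qf i)| * fmin.
have G0 i : 0 < G i.
  by rewrite mulr_gt0 // normr_gt0 subr_eq0 eq_sym.
pose b := \big[Num.min/G (Ordinal n0)]_(j < n) G j.
exists b; first by apply: lt_bigmin.
move=> i; split; last exact: bigmin_le.
congr (_ * _); apply/le_anti/andP; split; apply: le_bigmin => //.
- exact: (bigmin_le _ (Ordinal n0)).
- by move=> j _; exact: bigmin_le.
- exact: bigmin_le.
- by move=> j _; exact: bigmin_le.
Qed.

Theorem theorem1 (R : realType) (d dU dW : measure_display)
  (T : measurableType d) (U : measurableType dU) (W : measurableType dW)
  (Pr : probability T R) (n p : nat) (hn : (0 < n)%N) (hp : (0 < p)%N)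
  (* graph *)
  (A : 'M[R]_n) (hA : weighted_adjacency A)
  (* model *)
  (theta : 'cV[R]_p) (C : R) (pf qf : 'I_n -> R)
  (u : nat -> 'I_n -> {mfun T >-> U}) (w' : nat -> 'I_n -> {mfun T >-> W})
  (w y : nat -> 'I_n -> {mfun T >-> R})
  (phi : nat -> 'I_n -> T -> 'cV[R]_p) (s : nat -> 'I_n -> T -> bool)
  (hy : forall k i x, y k.+1 i x = ((phi k i x)^T *m theta) 0 0 + w k.+1 i x)
  (hpf : forall i, 0 <= pf i < 1) (hqf : forall i, 0 <= qf i < 1)
  (hs1 : forall k i, cond_prob_on Pr (natural_filtration y u w w' k)
     [set x | s k.+1 i x = false] [set x | y k.+1 i x <= C] (pf i))
  (hs0 : forall k i, cond_prob_on Pr (natural_filtration y u w w' k)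
     [set x | s k.+1 i x = true] (~` [set x | y k.+1 i x <= C]) (qf i))
  (hs : forall k j i, (0 < j <= k)%N ->
     measurable_wrt (natural_filtration y u w w' k) (s j i))
  (* Assumption 1 *)
  (Om : set 'cV[R]_p) (hOm0 : Om !=set0) (hOmk : compact Om)
  (hOmc : convex_set Om) (htheta : Om theta)
  (L : R) (hL : L = sup [set enorm eta | eta in Om])
  (* Assumption 2 *)
  (hphi : forall k i (l : 'I_p), measurable_wrt (natural_filtration y u w w' k)
     (fun x => phi k i x l 0))
  (M : R) (hM : {ae Pr, forall x, forall k i, enorm (phi k i x) <= M})
  (* Assumption 3 *)
  (F f : nat -> 'I_n -> T -> R -> R)
  (hF : forall k i, is_cond_distribution Pr (natural_filtration y u w w' k)
     (w k.+1 i) (F k i) (f k i))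
  (hind : forall k, cond_independent Pr (natural_filtration y u w w' k)
     (fun i => w k.+1 i : T -> R))
  (fmin : R) (hfmin0 : 0 < fmin)
  (hfmin : {ae Pr, forall x, forall k i z,
     z \in `[C - L * M, C + L * M] -> fmin <= f k i x z})
  (* Assumption 4 *)
  (hG : graph_connected A)
  (hpq : forall i, pf i + qf i != 1)
  (* algorithm *)
  (theta0 : 'I_n -> 'cV[R]_p) (htheta0 : forall i, Om (theta0 i))
  (P0 : 'I_n -> 'M[R]_p) (hP0 : forall i, sym_posdef (P0 i))
  (thetah psi : nat -> 'I_n -> T -> 'cV[R]_p)
  (P Pbar : nat -> 'I_n -> T -> 'M[R]_p)
  (hrun : forall x, algorithm_run A Om C pf qf (beta_coef pf qf fmin) theta0 P0
     (fun k i => phi k i x) (fun k i => F k i x) (fun k i => s k i x)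
     (fun k i => thetah k i x) (fun k i => P k i x)
     (fun k i => psi k i x) (fun k i => Pbar k i x)) :
  {ae Pr, forall x,
    let Theta k := stack_col (fun i => thetah k i x - theta) in
    let Phi k := stack_diag (fun i => phi k i x) in
    let PP k := stack_diag (fun i => P k i x) in
    let r := rsum P0 (fun k i => phi k i x) in
    bigO_log (fun t => \sum_(0 <= k < t.+1)
      ((Theta k)^T *m Phi k *m (Phi k)^T *m Theta k) 0 0) r /\
    bigO_log (fun t =>
      ((Theta t.+1)^T *m invmx (PP t.+1) *m Theta t.+1) 0 0) r}.
Proof.
have [b b0 hb] := beta_coef_common hfmin0 hpq hn.
pose gen := natural_generator (fun k i => y k i : T -> R) (fun k i => u k i : T -> U)
  (fun k i => w k i : T -> R) (fun k i => w' k i : T -> W).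
have gen_homo k : <<s gen k>> `<=` <<s gen k.+1>>.
  exact: natural_filtration_homo.
have gen_meas k : <<s gen k>> `<=` @measurable d T.
  exact: natural_filtration_measurable.
have hs' k i : measurable_wrt (<<s gen k.+1>>) (s k.+1 i).
  by apply: hs; rewrite leqnn.
(* The absolute value gives nonnegativity at once, before a sample point is fixed at which [M] is
   seen to bound a norm. *)
pose B := `|L * M|.
have hnull k i : null_mean Pr (gen k) (fun x => (1 - (pf i + qf i)) *
    F k i x (C - dotv theta (phi k i x)) + qf i - (s k.+1 i x)%:R).
  apply: (null_mean_bit (@gen_meas k) (w := w k.+1 i) (y := y k.+1 i)
    (X := fun x => C - dotv theta (phi k i x)) _ _ _ _ _ (hs1 k i) (hs0 k i) (hF k i)).
  - exact: measurable_funPT.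
  - exact: measurable_funPT.
  - by move=> _ Y mY; apply: (@gen_meas k.+1); apply: hs'; exists Y.
  - apply/measurable_wrtP; apply: measurable_funB; first exact: measurable_cst.
    apply: measurable_dotv; first exact: mx_measurable_cst.
    exact: (regressor_measurable hphi).
  - by move=> x; rewrite hy -/(dotv _ _) dotvC lerBrDl.
have hmart i := clipped_noise_bound (w := fun k i => w k i : T -> R) (gen := gen)
  (th := theta) (B := B) gen_homo hA hOm0 hOmk hOmc hP0 hphi hs' hF hrun
  gen_meas (normr_ge0 _) b0 hpf hqf hpq hnull i.
have {}hmart := @filter_forall T 'I_n _ _ (ae_filter_ringOfSetsType Pr) hmart.
move: hM hfmin hmart.
apply: filterS3 => x {}hM {}hfmin {}hmart.
set r := rsum _ _.
pose Theta k := stack_col (fun i => thetah k i x - theta).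
have i0 : 'I_n := Ordinal hn.
have M0 : 0 <= M by apply: le_trans (sqrtr_ge0 _) (hM 0%N i0).
have Lub := compact_enorm_ub hOm0 hOmk.
have Lle v : Om v -> enorm v <= L.
  by move=> Ov; rewrite hL; apply: ub_le_sup => //; exists v.
have L0 : 0 <= L by apply: le_trans (sqrtr_ge0 _) (Lle _ htheta).
have BE : B = L * M by rewrite /B ger0_norm // mulr_ge0.
have hB k i v : Om v -> - B <= dotv v (phi k i x) <= B.
  move=> Ov; rewrite -ler_norml BE; apply: le_trans (dotv_le_enorm _ _) _.
  by apply: ler_pM; rewrite ?sqrtr_ge0 // Lle.
have F01 k i c : 0 <= F k i x c <= 1.
  by have [/(_ x)[fm f0 f1 FE] _] := hF k i; exact: (density_cdf_01 fm f0 f1 FE).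
have Fm k i : {homo F k i x : a c / a <= c}.
  by have [/(_ x)[fm f0 f1 FE] _] := hF k i; exact: (density_cdf_homo fm f0 FE).
have Fi k i a c : C - B <= a -> a <= c -> c <= C + B ->
    fmin * (c - a) <= F k i x c - F k i x a.
  have [/(_ x)[fm f0 f1 FE] _] := hF k i.
  apply: (density_cdf_increment_ge fm f0 FE) => z zCB; apply: hfmin.
  by rewrite in_itv /= -BE.
have [K hK] := choice hmart.
have [c [K1 [K2 [T0 [c0 K20 T00 hbound]]]]] : exists c K1 K2 T0,
  [/\ 0 < c, 0 <= K2, 0 <= T0 & forall t r,
    \sum_(k < t) \sum_i enorm (phi k i x) ^+ 2 <= r ->
    c * (\sum_(k < t) \sum_i dotv (phi k i x) (thetah k i x - theta) ^+ 2) +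
    energy (fun k i => thetah k i x) (fun k i => P k i x) theta t <=
    K1 + K2 * ln (T0 + b ^+ 2 * r)].
  apply: (energy_bound hA hP0 (hrun x) hOm0 hOmk hOmc htheta hB b0
    (fun i => (hb i).1) (fun i => (hb i).2) hpf hqf F01 Fm Fi (K := K) hM).
  (* At this sample point theta^T phi lies in [-B, B], so the extra clamp in the noise bound
     disappears. *)
  move=> t i; have := hK i t; congr (_ <= _ * _ + _).
    by apply: eq_bigr => k _; rewrite (hb i).1 /noise /clip
      [clamp B (dotv theta _)]clamp_id // hB.
  by apply: eq_bigr => k _; rewrite /clip [clamp B (dotv theta _)]clamp_id // hB.
have uP k i : P k i x \in unitmx.
  exact: posdef_unit (run_posdef hA hP0 (hrun x) k i).
have e0 t : 0 <= energy (fun k i => thetah k i x) (fun k i => P k i x) theta t.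
  apply: sumr_ge0 => i _; apply: posdef_ge0.
  exact: (info_posdef hA hP0 (hrun x)).
pose S t := \sum_(k < t.+1) \sum_i dotv (phi k i x) (thetah k i x - theta) ^+ 2.
have S0 t : 0 <= S t.
  by apply: sumr_ge0 => k _; apply: sumr_ge0 => i _; exact: sqr_ge0.
have X1E t : \sum_(0 <= k < t.+1) ((Theta k)^T *m stack_diag (fun i => phi k i x) *m
    (stack_diag (fun i => phi k i x))^T *m Theta k) 0 0 = S t.
  by rewrite big_mkord /S; apply: eq_bigr => k _; exact: stack_regression.
have X2E t : ((Theta t)^T *m invmx (stack_diag (fun i => P t i x)) *m Theta t) 0 0 =
    energy (fun k i => thetah k i x) (fun k i => P k i x) theta t.
  exact: stack_quad_form.
pose lm := \big[Num.max/0]_(i < n) lambda_max (P0 i).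
(* [ln 0 = 0], so [r t] must stay positive even when all regressors vanish. *)
have lm0 : 0 < lm.
  by apply: lt_le_trans (lambda_max_gt0 hp (hP0 i0)) _; exact: le_bigmax.
have rE t : r t = lm + \sum_(k < t.+1) \sum_i enorm (phi k i x) ^+ 2.
  rewrite /r /rsum -/lm [in RHS]exchange_big /=; congr (_ + _).
  by apply: eq_bigr => i _; rewrite big_mkord.
have rh : {homo r : m t / (m <= t)%N >-> m <= t}.
  apply: homo_leq => [//|m1 m2 m3|t]; first exact: le_trans.
  rewrite !rE lerD2l [leRHS]big_ord_recr /= lerDl sumr_ge0 // => i _.
  exact: sqr_ge0.
have r0 : 0 < r 0%N.
  rewrite rE ltr_pwDl // sumr_ge0 // => k _; apply: sumr_ge0 => i _.
  exact: sqr_ge0.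
have hr t : c * S t + energy (fun k i => thetah k i x) (fun k i => P k i x) theta t.+1 <=
    K1 + K2 * ln (T0 + b ^+ 2 * r t).
  by apply: hbound; rewrite rE lerDr ltW.
have b20 : 0 < b ^+ 2 by rewrite exprn_gt0.
split.
- apply: (bigO_log_intro (K1 := K1 / c) (K2 := K2 / c) _ _ T00 b20 rh r0) => [t||t].
  + by rewrite X1E.
  + by rewrite divr_ge0 // ltW.
  + rewrite X1E mulrAC -mulrDl ler_pdivlMr // mulrC.
    by apply: le_trans (hr t); rewrite lerDl.
- apply: (bigO_log_intro _ K20 T00 b20 rh r0) => t; rewrite X2E //.
  by apply: le_trans (hr t); rewrite lerDr mulr_ge0 // ltW.
Qed.
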